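(* Let $\mathcal X,\mathcal Y$ be finite alphabets and let $n\ge 1$ be a fixed integer. Then both sets $$S_>=\{(A,W)\in\mathcal M_c^{n\times n}\times\mathcal{CH}_c(\mathcal X,\mathcal Y):\eta(A)-C(W)>0\},$$ $$S_<=\{(A,W)\in\mathcal M_c^{n\times n}\times\mathcal{CH}_c(\mathcal X,\mathcal Y):\eta(A)-C(W)<0\}$$ are semi-decidable (as subsets of $\mathcal M_c^{n\times n}\times \mathcal{CH}_c(\mathcal X,\mathcal Y)$).
   Context: Computability. A sequence of rationals $(r_k)_{k\in\mathbb N}$ is computable if $r_k=(-1)^{s(k)}a(k)/b(k)$ for recursive functions $a,b,s:\mathbb N\to\mathbb N$ with $b(k)\neq 0$ for all $k$. A real $x$ is computable if there is a computable sequence of rationals $(r_k)$ with $|x-r_k|<2^{-k}$ for all $k$; $\mathbb R_c$ is the set of computable reals. A computable real is given as input to a Turing machine by a description (a program) of such a sequence; computable matrices and computable channels are given by descriptions of all their entries. A subset $M$ of a set $D$ of such objects is semi-decidable if there is a Turing machine (with the single output state ''stop'') that, for every input in $D$, halts if the input lies in $M$ and computes forever if it does not. Plants. $\mathcal M_c^{n\times n}$ is the set of $n\times n$ matrices $A$ with entries in $\mathbb R_c$ that are unstable, i.e. have at least one eigenvalue $\lambda$ with $|\lambda|\ge 1$. With $\lambda_1(A),\dots,\lambda_n(A)$ the (complex) eigenvalues of $A$ repeated according to algebraic multiplicity, $\eta(A)=\sum_{j:|\lambda_j(A)|\ge 1}\log_2|\lambda_j(A)|$. Channels. $\mathcal{CH}_c(\mathcal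 X,\mathcal Y)$ is the set of computable channels, i.e. families $W=(W(y|x))_{x\in\mathcal X,y\in\mathcal Y}$ such that for each $x$, $W(\cdot|x)$ is a probability distribution on $\mathcal Y$ with all values in $\mathbb R_c$. $C(W)$ denotes the ordinary Shannon capacity (in bits) of the discrete memoryless channel $W$, i.e. the supremum of all rates achievable with vanishing maximal error probability; equivalently $C(W)=\max_P I(P;W)$, the maximum over probability distributions $P$ on $\mathcal X$ of the mutual information (logarithms to base 2) between channel input and output. *)

(* Defs.v *)
From HB Require Import structures.
From mathcomp Require Import all_boot all_order all_algebra.
From mathcomp Require Import all_classical all_reals.
From mathcomp Require Import exp.
From mathcomp.real_closed Require Import complex.

Set Implicit Arguments.
Unset Strict Implicit.
Unset Printing Implicit Defensive.

Import Order.TTheory GRing.Theory Num.Theory.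

(* Terms for Kleene's partial recursive functions.  Arities are not recorded:
   [reval e v y] (e is defined on the argument list v, with value y) fails
   when the length of v is not suitable for e. *)
Inductive recf : Type :=
| RZero
| RSucc
| RProj of nat
| RComp of recf & seq recf
| RPrec of recf & recf
| RMin of recf.

Inductive reval : recf -> seq nat -> nat -> Prop :=
| EvZero v : reval RZero v 0
| EvSucc x : reval RSucc [:: x] x.+1
| EvProj i v : i < size v -> reval (RProj i) v (nth 0 v i)
| EvComp f gs v w y :
    size w = size gs ->
    (forall i, i < size gs -> reval (nth RZero gs i) v (nth 0 w i)) ->
    reval f w y -> reval (RComp f gs) v y
| EvPrec0 f g v y : reval f v y -> reval (RPrec f g) (0 :: v) y
| EvPrecS f g n v z y :
    reval (RPrec f g) (n :: v) z -> reval g [:: n, z & v] y ->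
    reval (RPrec f g) (n.+1 :: v) y
| EvMin f v y (u : nat -> nat) :
    (forall i, i < y -> reval f (i :: v) (u i).+1) ->
    reval f (y :: v) 0 -> reval (RMin f) v y.

Definition computes (e : recf) (f : nat -> nat) : Prop :=
  forall k, reval e [:: k] (f k).

(* Cantor's bijection between nat * nat and nat. *)
Definition npair (x y : nat) : nat := ((x + y) * (x + y).+1)./2 + y.

Fixpoint gnum (e : recf) : nat :=
  match e with
  | RZero => npair 0 0
  | RSucc => npair 1 0
  | RProj i => npair 2 i
  | RComp f gs =>
      npair 3 (npair (gnum f) (foldr (fun g c => (npair (gnum g) c).+1) 0 gs))
  | RPrec f g => npair 4 (npair (gnum f) (gnum g))
  | RMin f => npair 5 (gnum f)
  end.

(* A program for a sequence of rationals (-1)^s(k) a(k) / b(k). *)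
Record ratprog : Type := RatProg { num_prog : recf; den_prog : recf; sgn_prog : recf }.

Definition ratprog_num (d : ratprog) : nat :=
  npair (gnum (num_prog d)) (npair (gnum (den_prog d)) (gnum (sgn_prog d))).

Definition ratprog_computes (d : ratprog) (r : nat -> rat) : Prop :=
  exists a b s : nat -> nat,
    [/\ computes (num_prog d) a, computes (den_prog d) b,
        computes (sgn_prog d) s, forall k, b k != 0
      & forall k, r k = ((-1) ^+ s k * (a k)%:R / (b k)%:R)%R].

Definition describes (R : realType) (d : ratprog) (x : R) : Prop :=
  exists2 r : nat -> rat, ratprog_computes d r
    & forall k, (`|x - ratr (r k)| < 2 ^- k)%R.

Definition computable_real (R : realType) (x : R) : Prop :=
  exists d : ratprog, describes d x.

Inductive move : Type := MoveL | MoveN | MoveR.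

(* Deterministic machine with [tm_work] work tapes besides the input tape
   (tape 0).  All tapes are two-way infinite, over the alphabet
   {blank, 0, 1} = option bool. *)
Record TM : Type := MkTM {
  tm_work : nat;
  tm_state : finType;
  tm_start : tm_state;
  tm_stop : tm_state;
  tm_delta : tm_state -> {ffun 'I_tm_work.+1 -> option bool} ->
             tm_state * {ffun 'I_tm_work.+1 -> option bool * move} }.

Record tm_config (T : TM) : Type := MkConfig {
  cfg_state : tm_state T;
  cfg_cell : 'I_(tm_work T).+1 -> int -> option bool;
  cfg_head : 'I_(tm_work T).+1 -> int }.

Definition shift (m : move) (p : int) : int :=
  match m with MoveL => p - 1 | MoveN => p | MoveR => p + 1 end%R.

Definition tm_step (T : TM) (c : tm_config T) : tm_config T :=
  let: (q, act) :=
    tm_delta (cfg_state c) [ffun j => cfg_cell c j (cfg_head c j)] in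
  MkConfig q
    (fun j p => if p == cfg_head c j then (act j).1 else cfg_cell c j p)
    (fun j => shift (act j).2 (cfg_head c j)).

Definition tm_init (T : TM) (w : seq bool) : tm_config T :=
  MkConfig (tm_start T)
    (fun j p => match p with
                | Posz i => if j == ord0 then onth w i else None
                | Negz _ => None
                end)
    (fun=> 0%R).

Definition tm_halts (T : TM) (w : seq bool) : Prop :=
  exists t, cfg_state (iter t (@tm_step T) (tm_init T w)) = tm_stop T.

(* The Gödel numbers of the programs of the entries, in the order of [enum I],
   each written as 1...10. *)
Definition input_word (I : finType) (d : I -> ratprog) : seq bool :=
  flatten [seq rcons (nseq (ratprog_num (d i)) true) false | i <- enum I].

Local Open Scope classical_set_scope.

(* D is a set of objects given by finitely many real entries.  The machine has
   to be correct on every description of every object of D; nothing is required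
   on other inputs. *)
Definition semi_decidable (R : realType) (I : finType) (O : Type)
    (entry : O -> I -> R) (D M : set O) : Prop :=
  M `<=` D /\
  exists T : TM, forall (x : O) (d : I -> ratprog),
    D x -> (forall i, describes (d i) (entry x i)) ->
    (tm_halts T (input_word d) <-> M x).

Local Open Scope ring_scope.

Definition log2 (R : realType) (x : R) : R := ln x / ln 2.

Definition complex_mx (R : realType) (n : nat) (A : 'M[R]_n) : 'M[R[i]%C]_n :=
  map_mx (fun a : R => (a%:C)%C) A.

Definition modulus (R : realType) (z : R[i]%C) : R := ComplexField.Normc.normc z.

(* The roots of the characteristic polynomial, with multiplicity. *)
Definition eigenvalues (R : realType) (n : nat) (A : 'M[R]_n) : seq R[i]%C :=
  sval (closed_field_poly_normal (char_poly (complex_mx A))).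

Definition plant (R : realType) (n : nat) : set 'M[R]_n :=
  [set A : 'M[R]_n | (forall i j, computable_real (A i j)) /\
           exists2 z : R[i]%C, eigenvalue (complex_mx A) z & 1 <= modulus z].

Definition eta (R : realType) (n : nat) (A : 'M[R]_n) : R :=
  \sum_(z <- eigenvalues A | 1 <= modulus z) log2 (modulus z).

Definition is_distr (R : realType) (X : finType) (P : X -> R) : Prop :=
  (forall x, 0 <= P x) /\ \sum_x P x = 1.

(* [W x y] is the transition probability W(y|x). *)
Definition computable_channel (R : realType) (X Y : finType) : set (X -> Y -> R) :=
  [set W : X -> Y -> R | forall x, is_distr (W x) /\ forall y, computable_real (W x y)].

(* Terms with P x * W x y = 0 vanish, as in the convention 0 log 0 = 0. *)
Definition mutual_info (R : realType) (X Y : finType)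
    (P : X -> R) (W : X -> Y -> R) : R :=
  \sum_x \sum_y
    P x * W x y * log2 (W x y / \sum_x' P x' * W x' y).

Definition capacity (R : realType) (X Y : finType) (W : X -> Y -> R) : R :=
  sup [set mutual_info P W | P in [set P : X -> R | is_distr P]].

Definition pair_entry (R : realType) (X Y : finType) (n : nat)
    (p : 'M[R]_n * (X -> Y -> R)) (i : ('I_n * 'I_n) + (X * Y)) : R :=
  match i with
  | inl ij => p.1 ij.1 ij.2
  | inr xy => p.2 xy.1 xy.2
  end.

Definition plant_channel (R : realType) (X Y : finType) (n : nat) :
    set ('M[R]_n * (X -> Y -> R)) :=
  @plant R n `*` @computable_channel R X Y.

Definition S_gt (R : realType) (X Y : finType) (n : nat) :
    set ('M[R]_n * (X -> Y -> R)) :=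
  [set p : 'M[R]_n * (X -> Y -> R) | plant_channel p /\ eta p.1 - capacity p.2 > 0].

Definition S_lt (R : realType) (X Y : finType) (n : nat) :
    set ('M[R]_n * (X -> Y -> R)) :=
  [set p : 'M[R]_n * (X -> Y -> R) | plant_channel p /\ eta p.1 - capacity p.2 < 0].

(* Main.v *)
Require Import Defs.
From mathcomp Require Import all_boot all_order all_algebra.
From mathcomp Require Import all_classical all_reals.
From mathcomp Require Import perm sequences exp.
From mathcomp.real_closed Require Import complex.
From mathcomp Require Import zify ring lra.

(** Both sets are open conditions between two computable quantities. Up to the
    common factor [ln 2], the topological entropy [eta A] and the capacity
    [capacity W] are shown to be real functions of the instance whose lower and
    upper cuts are recursively enumerable, uniformly in the description of the
    entries ([creal_eta], [creal_capacity]). Then [x < y] is recursively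
    enumerable for two such functions, since it is witnessed by a rational in
    between ([creal_lt]), and the theorem follows once recursive enumerability is
    known to yield a machine.

    Machines. A set is enumerable in the sense used here when it is the projection
    of a primitive recursive set. Primitive recursive functions of one argument
    are compiled to programs over counters, and a counter is the position of a
    head on a work tape with one marked cell; an unbounded search through the
    witnesses then gives [reN_machine]. Closure
    properties take the place of further programming: enumerable predicates are
    closed under conjunction, disjunction, existential quantification and
    inductive definitions ([re_derivable]). In particular, evaluation of Goedel numbers is enumerable
    ([re_evaluates]), so described reals have enumerable cuts
    ([creal_described]).

    Capacity. The mutual information is lower semicontinuous in a strong sense
    ([info_scale]), so that capacity exceeds [r] as soon as a rational input
    distribution does better than [r] ([capacity_gt]). For upper bounds one needs
    the dual description of capacity as the least radius, in the sense of
    divergence, of a ball containing all rows of the channel. If [P] is within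
    [t * e] of the optimum [C], then moving mass [t] to a letter [x] gains at most
    [t * e], whence the row of [x] has divergence at most [C + e] from the output
    of the perturbed distribution ([kl_perturbed]); all these outputs are dominated,
    up to a factor close to 1, by a single one, which can be made rational
    ([capacity_lt]).

    Entropy. [eta A] is the logarithm of the Mahler measure [M] of the
    characteristic polynomial. The roots themselves are avoided: Graeffe's
    operation squares the roots of a polynomial and acts on its coefficients by
    quadratic forms. After [k] steps the sum of the squared coefficients lies
    between [M ^ N] and [4 ^ n * M ^ N], where [N = 2 ^ k.+1]; the lower bound is
    Landau's inequality ([energy_graeffe_bounds]). Dividing logarithms by [N]
    yields [ln M] with a computable rate of convergence. The iteration, whose
    length is not fixed, is carried out on rational vectors together with a bound
    for their error ([creal_energy]). *)

Set Implicit Arguments.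
Unset Strict Implicit.
Unset Printing Implicit Defensive.

Import Order.TTheory GRing.Theory Num.Theory.

(** * Cantor pairing and primitive recursive functions of one argument *)

Fixpoint unpair (n : nat) : nat * nat :=
  if n is m.+1 then
    if unpair m is (x.+1, y) then (x, y.+1) else ((unpair m).2.+1, 0)
  else (0, 0).

Lemma triangleS m : (m.+1 * m.+2)./2 = (m * m.+1)./2 + m.+1.
Proof.
have -> : m.+1 * m.+2 = m * m.+1 + m.+1.*2 by rewrite -!mul2n; ring.
by rewrite halfD odd_double andbF add0n doubleK.
Qed.

Lemma npairSr x y : npair x y.+1 = (npair x.+1 y).+1.
Proof. by rewrite /npair addnS addSn addnS. Qed.

Lemma npairS0 y : npair y.+1 0 = (npair 0 y).+1.
Proof. by rewrite /npair !addn0 add0n triangleS addnS. Qed.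

Lemma unpairK n : npair (unpair n).1 (unpair n).2 = n.
Proof.
elim: n => [//|n IH] /=; case: (unpair n) IH => [[|x] y] /= <-.
  exact: npairS0.
exact: npairSr.
Qed.

Lemma npairK x y : unpair (npair x y) = (x, y).
Proof.
have [n] := ubnPeq (npair x y); elim: n x y => [|n IH] x [|y].
- case: x => [//|x]; by rewrite npairS0.
- by rewrite npairSr.
- case: x => [|x]; first by rewrite /npair.
  by rewrite npairS0 => /eqP [] /eqP /IH /= ->.
by rewrite npairSr => /eqP [] /eqP /IH /= ->.
Qed.

(** Recursion with parameters is plain iteration of a map on a state coded by
    pairs, so these seven constructors give all primitive recursive functions. *)
Inductive prf : Type :=
| PZero
| PSucc
| PFst
| PSnd
| PComp of prf & prf
| PPair of prf & prf
| PIter of prf.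

Fixpoint pev (e : prf) (n : nat) : nat :=
  match e with
  | PZero => 0
  | PSucc => n.+1
  | PFst => (unpair n).1
  | PSnd => (unpair n).2
  | PComp f g => pev f (pev g n)
  | PPair f g => npair (pev f n) (pev g n)
  | PIter f => iter (unpair n).2 (pev f) (unpair n).1
  end.

(** * Structured counter programs *)

(** A store consists of the registers and the unread part of the input, to which
    [Read] is the only access: it consumes one number written in unary. *)
Inductive cmd : Type :=
| Inc of nat
| Dec of nat
| Read of nat
| Seq of cmd & cmd
| While of nat & cmd.

Definition upd (s : nat -> nat) (r v : nat) : nat -> nat :=
  fun i => if i == r then v else s i.

Definition store : Type := ((nat -> nat) * seq bool)%type.

Inductive exec : cmd -> store -> store -> Prop :=
| EInc r s w : exec (Inc r) (s, w) (upd s r (s r).+1, w)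
| EDec r s w : exec (Dec r) (s, w) (upd s r (s r).-1, w)
| ERead r s k w :
    exec (Read r) (s, nseq k true ++ false :: w) (upd s r (s r + k), w)
| ESeq a b c1 c2 c3 : exec a c1 c2 -> exec b c2 c3 -> exec (Seq a b) c1 c3
| EWhile0 r a s w : s r = 0 -> exec (While r a) (s, w) (s, w)
| EWhileS r a s w c2 c3 :
    s r <> 0 -> exec a (s, w) c2 -> exec (While r a) c2 c3 ->
    exec (While r a) (s, w) c3.

Lemma exec_eq c s w s' s'' :
  exec c (s, w) (s', w) -> s' =1 s'' -> exec c (s, w) (s'', w).
Proof. by move=> H /funext <-. Qed.

(** The store when the loop counter [r] shows [n] is [S n]; the loop counts
    down from [N] to [0]. *)
Lemma exec_loop r c (S : nat -> nat -> nat) N s s' w :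
  S N =1 s -> S 0 =1 s' -> (forall n, S n r = n) ->
  (forall n, n < N -> exec c (S n.+1, w) (S n, w)) ->
  exec (While r c) (s, w) (s', w).
Proof.
move=> /funext <- /funext <- Sr; elim: N => [|N IH] H; first exact: EWhile0.
apply: EWhileS; first by rewrite Sr.
- exact: H.
by apply: IH => n ltnN; apply: H; rewrite ltnW.
Qed.

Ltac upd_at :=
  rewrite /upd /=; repeat (case: eqP => ?; try subst);
  try solve [lia | congruence].

Ltac upd_cases := let i := fresh "i" in move=> i; upd_at.

Ltac upd_tac := solve [upd_cases | upd_at].

Definition Clear (t : nat) : cmd := While t (Dec t).

Lemma exec_clear t s w : exec (Clear t) (s, w) (upd s t 0, w).
Proof.
apply: (exec_loop (S := fun n => upd s t n) (N := s t)); try upd_tac.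
by move=> n _; apply: (exec_eq (EDec _ _ _)); upd_tac.
Qed.

Definition Move (r a : nat) : cmd := While r (Seq (Dec r) (Inc a)).

Lemma exec_move r a s w : r <> a ->
  exec (Move r a) (s, w) (upd (upd s a (s a + s r)) r 0, w).
Proof.
move=> ra.
apply: (exec_loop (S := fun n => upd (upd s a (s a + (s r - n))) r n)
                  (N := s r)); try upd_tac.
move=> n ltn; apply: ESeq (EDec _ _ _) _.
by apply: (exec_eq (EInc _ _ _)); upd_tac.
Qed.

Definition Copy (r a t : nat) : cmd :=
  Seq (While r (Seq (Dec r) (Seq (Inc a) (Inc t)))) (Move t r).

Lemma exec_copy r a t s w : r <> a -> r <> t -> a <> t -> s t = 0 ->
  exec (Copy r a t) (s, w) (upd s a (s a + s r), w).
Proof.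
move=> ra rt at_ st; apply: ESeq.
  apply: (exec_loop (N := s r)
    (S := fun n => upd (upd (upd s a (s a + (s r - n))) r n) t (s r - n)));
    first by upd_tac.
  - by move=> i; reflexivity.
  - by upd_tac.
  move=> n ltn; apply: ESeq (EDec _ _ _) _; apply: ESeq (EInc _ _ _) _.
  by apply: (exec_eq (EInc _ _ _)); upd_tac.
by apply: (exec_eq (exec_move _ _ _)); [congruence | upd_tac].
Qed.

(** The scratch register [k] receives [a] and then, added to it, the triangular
    number of [r + a]. *)
Definition Pair (r a k : nat) : cmd :=
  Seq (Copy a k k.+1) (Seq (Move a r)
    (Seq (While r (Seq (Copy r k k.+1) (Dec r))) (Move k r))).

Lemma exec_pair r a k s w : r < k -> a < k -> r <> a -> s k = 0 -> s k.+1 = 0 ->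
  exec (Pair r a k) (s, w) (upd (upd s r (npair (s r) (s a))) a 0, w).
Proof.
move=> rk ak ra sk sk1.
apply: ESeq (exec_copy _ _ _ _ _) _ => //; try lia.
apply: ESeq (exec_move _ _ _) _; first lia.
pose T n := (n * n.+1)./2.
apply: ESeq.
  apply: (exec_loop (N := s r + s a)
    (S := fun n => upd (upd (upd s a 0) r n) k (s a + (T (s r + s a) - T n))));
    first by upd_tac.
  - by move=> i; reflexivity.
  - by upd_tac.
  move=> n ltn; apply: ESeq (exec_copy _ _ _ _ _) _; try lia; first by upd_tac.
  apply: (exec_eq (EDec _ _ _)).
  have Tn : T n.+1 = T n + n.+1 by rewrite /T triangleS.
  have leT : T n.+1 <= T (s r + s a).
    by rewrite /T half_leq // leq_mul.
  by clearbody T; upd_tac.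
apply: (exec_eq (exec_move _ _ _)); first lia.
by rewrite /T /npair; upd_tac.
Qed.

(** One step of the enumeration of pairs. The language has no conditional: the
    register [t] is a flag, reset by the only pass through the first loop when
    [x] is positive and still set after it when [x] is zero. *)
Definition NextPair (x y t u : nat) : cmd :=
  Seq (Inc t)
  (Seq (While x (Seq (Dec x) (Seq (Inc y) (Seq (Dec t) (Move x u)))))
  (Seq (Move u x)
  (While t (Seq (Dec t) (Seq (Move y x) (Inc x)))))).

Lemma exec_nextpair x y t u n s w :
  uniq [:: x; y; t; u] -> s x = (unpair n).1 -> s y = (unpair n).2 ->
  s t = 0 -> s u = 0 ->
  exec (NextPair x y t u) (s, w)
    (upd (upd s x (unpair n.+1).1) y (unpair n.+1).2, w).
Proof.
rewrite /= !inE !negb_or => /and4P [/and3P [/eqP ? /eqP ? /eqP ?]].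
move=> /andP [/eqP ? /eqP ?] /eqP ? _.
case: (unpair n) => -[|x'] y' /= sx sy st su; apply: ESeq (EInc _ _ _) _.
  apply: ESeq; first by apply: EWhile0; upd_tac.
  apply: ESeq (exec_move _ _ _) _; first congruence.
  apply: EWhileS; first by upd_tac.
  - apply: ESeq (EDec _ _ _) _; apply: ESeq (exec_move _ _ _) _; first congruence.
    exact: EInc.
  match goal with |- exec _ (?s1, _) _ => apply: (exec_eq (s' := s1)) end.
    by apply: EWhile0; upd_tac.
  by upd_tac.
apply: ESeq.
  apply: EWhileS; first by upd_tac.
    apply: ESeq (EDec _ _ _) _; apply: ESeq (EInc _ _ _) _.
    apply: ESeq (EDec _ _ _) _; apply: exec_move; congruence.
  by apply: EWhile0; upd_tac.
apply: ESeq (exec_move _ _ _) _; first congruence.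
match goal with |- exec _ (?s1, _) _ => apply: (exec_eq (s' := s1)) end.
  by apply: EWhile0; upd_tac.
by upd_tac.
Qed.

(** Decoding counts up through the enumeration of pairs while [r] counts down. *)
Definition Unpair (r k : nat) : cmd :=
  Seq (While r (Seq (Dec r) (NextPair k.+2 k k.+1 k.+3))) (Move k.+2 r).

Lemma exec_unpair r k s w : r < k -> (forall i, k <= i -> s i = 0) ->
  exec (Unpair r k) (s, w)
    (upd (upd s r (unpair (s r)).1) k (unpair (s r)).2, w).
Proof.
move=> rk s0; apply: ESeq.
  apply: (exec_loop (N := s r)
    (S := fun n => upd (upd (upd s r n) k.+2 (unpair (s r - n)).1)
                     k (unpair (s r - n)).2)).
  - by rewrite subnn; upd_cases; apply/esym/s0; lia.
  - by move=> i; reflexivity.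
  - by upd_tac.
  move=> n ltn; apply: ESeq (EDec _ _ _) _.
  apply: (exec_eq (exec_nextpair (n := s r - n.+1) _ _ _ _ _ _)).
  - by rewrite /= !inE; lia.
  - by upd_tac.
  - by upd_tac.
  - by upd_at; apply/s0; lia.
  - by upd_at; apply/s0; lia.
  by rewrite -subSn // subSS; upd_tac.
apply: (exec_eq (exec_move _ _ _)); first lia.
rewrite subn0; upd_cases; rewrite ?s0 //; lia.
Qed.

(** The registers from [k] on are scratch: every program finds and leaves them at
    zero, so that programs can be composed without any bookkeeping. *)
Fixpoint compile (e : prf) (r k : nat) : cmd :=
  match e with
  | PZero => Clear r
  | PSucc => Inc r
  | PFst => Seq (Unpair r k) (Clear k)
  | PSnd => Seq (Unpair r k) (Seq (Clear r) (Move k r))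
  | PComp f g => Seq (compile g r k) (compile f r k)
  | PPair f g =>
      Seq (Copy r k k.+1)
        (Seq (compile f r k.+1) (Seq (compile g k k.+1) (Pair r k k.+1)))
  | PIter f => Seq (Unpair r k) (While k (Seq (Dec k) (compile f r k.+1)))
  end.

Lemma compileP e r k s w : r < k -> (forall i, k <= i -> s i = 0) ->
  exec (compile e r k) (s, w) (upd s r (pev e (s r)), w).
Proof.
elim: e r k s => [||||f IHf g IHg|f IHf g IHg|f IHf] r k s rk s0 /=.
- exact: exec_clear.
- exact: EInc.
- apply: ESeq (exec_unpair _ _ _) _ => //.
  apply: (exec_eq (exec_clear _ _ _)); by upd_cases; rewrite s0.
- apply: ESeq (exec_unpair _ _ _) _ => //.
  apply: ESeq (exec_clear _ _ _) _.
  apply: (exec_eq (exec_move _ _ _)); first lia.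
  by upd_cases; rewrite s0.
- apply: ESeq (IHg _ _ _ rk s0) _.
  apply: (exec_eq (IHf _ _ _ rk _)) => [i ki|]; last by upd_tac.
  by rewrite -(s0 i ki); move: i ki; rewrite /upd => i ki; case: eqP => // ?; lia.
- apply: ESeq (exec_copy _ _ _ _ _) _; try lia; first by rewrite s0.
  have aux a v s1 : a < k.+1 -> (forall i, k < i -> s1 i = 0) ->
      forall i, k < i -> upd s1 a v i = 0.
    by move=> ak s10 i ki; rewrite /upd; case: eqP => [?|_]; [lia|exact: s10].
  have s1 : forall i, k < i -> upd s k (s k + s r) i = 0.
    by apply: aux => // i ki; apply: s0; lia.
  apply: ESeq (IHf _ _ _ _ _) _ => //; first lia.
  apply: ESeq (IHg _ _ _ _ _) _ => //; first by apply: aux => //; lia.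
  apply: (exec_eq (exec_pair _ _ _ _ _ _)); try lia.
  + by apply: (aux) => //; apply: aux => //; lia.
  + by apply: (aux) => //; apply: aux => //; lia.
  by upd_cases; rewrite (s0 k (leqnn k)).
apply: ESeq (exec_unpair _ _ _) _ => //.
set x := (unpair _).1; set N := (unpair _).2.
apply: (exec_loop (N := N)
  (S := fun n => upd (upd s r (iter (N - n) (pev f) x)) k n)).
- by rewrite subnn.
- by rewrite subn0; by upd_cases; rewrite s0.
- by upd_tac.
move=> n ltn; apply: ESeq (EDec _ _ _) _.
apply: (exec_eq (IHf _ _ _ _ _)); first lia.
  move=> i ki; upd_at; apply: s0; lia.
have -> : N - n = (N - n.+1).+1 by lia.
by upd_tac.
Qed.

(** * Counter programs on Turing machines *)

(** The control points, later the states of the machine, are read off the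
    structure of the program, which spares all address arithmetic. *)
Fixpoint point (c : cmd) : finType :=
  match c with
  | Seq a b => (point a + point b)%type
  | While _ a => option (point a)
  | _ => unit
  end.

Fixpoint entry (c : cmd) : point c :=
  match c with
  | Seq a b => inl (entry a)
  | While _ a => None
  | _ => tt
  end.

(** A step increments ([true]) or decrements ([false]) at most one register, and
    may drop the first input symbol. *)
Definition action : Type := (option (nat * bool) * bool)%type.

(** A step sees only the zero tests [z] of the registers and whether the next
    input symbol is a one, which is all that the heads of the machine can read.
    The next point is [None] when the program is left. *)
Fixpoint next (c : cmd) : point c -> (nat -> bool) -> bool ->
    option (point c) * action :=
  match c with
  | Inc r => fun _ _ _ => (None, (Some (r, true), false))
  | Dec r => fun _ z _ => (None, (if z r then None else Some (r, false), false))
  | Read r => fun _ _ b =>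
      if b then (Some tt, (Some (r, true), true)) else (None, (None, true))
  | Seq a b => fun q z i =>
      match q with
      | inl q => let x := next q z i in
          (Some (if x.1 is Some q' then inl q' else inr (entry b)), x.2)
      | inr q => let x := next q z i in (omap inr x.1, x.2)
      end
  | While r a => fun q z i =>
      match q with
      | None => (if z r then None else Some (Some (entry a)), (None, false))
      | Some q => let x := next q z i in (Some x.1, x.2)
      end
  end.

Definition effect (a : action) (x : store) : store :=
  (match a.1 with
   | Some (r, true) => upd x.1 r (x.1 r).+1
   | Some (r, false) => upd x.1 r (x.1 r).-1
   | None => x.1
   end, if a.2 then behead x.2 else x.2).

Definition control (c : cmd) : Type := (option (point c) * store)%type.

Definition mstep (c : cmd) (x : control c) : control c :=
  if x.1 is Some q then
    let y := next q (fun r => x.2.1 r == 0) (ohead x.2.2 == Some true) in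
    (y.1, effect y.2 x.2)
  else x.

Lemma mstepE c (q : point c) x :
  mstep (Some q, x) =
  let y := next q (fun r => x.1 r == 0) (ohead x.2 == Some true) in
  (y.1, effect y.2 x).
Proof. by []. Qed.

Definition start (c : cmd) (x : store) : control c := (Some (entry c), x).

Lemma mstep_exit c n x : iter n (@mstep c) (None, x) = (None, x).
Proof. by elim: n => //= n ->. Qed.

Lemma run_seql a b n q x x' :
  iter n (@mstep a) (Some q, x) = (None, x') ->
  exists m, iter m (@mstep (Seq a b)) (Some (inl q), x)
            = (Some (inr (entry b)), x').
Proof.
elim: n q x => [//|n IH] q x; rewrite iterSr mstepE /=.
set y := next _ _ _; case Ey: y.1 => [q1|].
  by case/IH => m Hm; exists m.+1; rewrite iterSr mstepE /= -/y Ey.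
by rewrite mstep_exit => -[<-]; exists 1; rewrite /= mstepE /= -/y Ey.
Qed.

Lemma run_seqr a b n (x : control b) :
  iter n (@mstep (Seq a b)) (omap inr x.1, x.2)
  = (omap inr (iter n (@mstep b) x).1, (iter n (@mstep b) x).2).
Proof. by elim: n => //= n ->; case: (iter n _ x) => -[q|] y. Qed.

Lemma run_while r a n q x x' :
  iter n (@mstep a) (Some q, x) = (None, x') ->
  exists m, iter m (@mstep (While r a)) (Some (Some q), x) = (Some None, x').
Proof.
elim: n q x => [//|n IH] q x; rewrite iterSr mstepE /=.
set y := next _ _ _; case Ey: y.1 => [q1|].
  by case/IH => m Hm; exists m.+1; rewrite iterSr mstepE /= -/y Ey.
by rewrite mstep_exit => -[<-]; exists 1; rewrite /= mstepE /= -/y Ey.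
Qed.

Lemma iter_trans T (f : T -> T) x y z n m :
  iter n f x = y -> iter m f y = z -> iter (m + n) f x = z.
Proof. by move=> <- <-; rewrite iterD. Qed.

Lemma exec_run c x x' : exec c x x' ->
  exists n, iter n (@mstep c) (start c x) = (None, x').
Proof.
elim=> {c x x'} [r s w|r s w|r s k w|a b x1 x2 x3 _ [n Hn] _ [m Hm]
               |r a s w sr|r a s w x2 x3 sr _ [n Hn] _ [m Hm]].
- by exists 1.
- exists 1; rewrite /= /mstep /= /effect /=; congr (_, (_, _)).
  by case: eqP => //= sr; apply: funext => i; rewrite /upd; case: eqP => // ->; rewrite sr.
- elim: k s => [|k IH] s.
    by exists 1; rewrite addn0 /= /mstep /effect /=; congr (_, (_, _));
      apply: funext => i; rewrite /upd; case: eqP => // ->.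
  have [n Hn] := IH (upd s r (s r).+1); exists n.+1; rewrite iterSr.
  rewrite mstepE /= /effect /= Hn; congr (_, (_, _)).
  by apply: funext => i; rewrite /upd eqxx addSnnS; case: eqP.
- have [k Hk] := run_seql b Hn; exists (m + k).
  apply: (iter_trans Hk); have := run_seqr a m (start b x2).
  by rewrite Hm.
- by exists 1; rewrite /= /mstep /= sr eqxx.
have [k Hk] := run_while r Hn; exists (m + (k + 1)).
apply: (iter_trans (iter_trans _ Hk) Hm).
by rewrite /= /mstep /start /= (introF eqP sr).
Qed.

Lemma run_loop r a s w x : s r <> 0 -> exec a (s, w) x ->
  exists n, iter n.+1 (@mstep (While r a)) (start (While r a) (s, w))
            = start (While r a) x.
Proof.
move=> sr /exec_run [n /(run_while r) [k Hk]]; exists k.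
by rewrite -addn1; apply: (iter_trans _ Hk); rewrite /= /mstep /= (introF eqP sr).
Qed.

Fixpoint regs (c : cmd) : seq nat :=
  match c with
  | Inc r | Dec r | Read r => [:: r]
  | Seq a b => regs a ++ regs b
  | While r a => r :: regs a
  end.

Lemma next_ext c (q : point c) z z' b : {in regs c, z =1 z'} ->
  next q z b = next q z' b.
Proof.
elim: c q => [r|r|r|a IHa b' IHb|r a IHa] q H //=.
- by rewrite H ?mem_head.
- case: q => q; [rewrite IHa // | rewrite IHb //] => i Hi;
    by apply: H; rewrite mem_cat Hi ?orbT.
case: q => [q|]; last by rewrite H ?mem_head.
by rewrite IHa // => i Hi; apply: H; rewrite inE Hi orbT.
Qed.

Lemma next_dec c (q : point c) z b r : (next q z b).2.1 = Some (r, false) -> ~~ z r.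
Proof.
elim: c q => [r'|r'|r'|a IHa b' IHb|r' a IHa] q //=.
- by case Ez: (z r') => //= -[<-]; rewrite Ez.
- by case: b.
- by case: q => q; [apply: IHa | apply: IHb].
by case: q => [q|] //; apply: IHa.
Qed.

Section Machine.
Variables (c : cmd) (K : nat).
Hypothesis regsK : {in regs c, forall r, r < K}.

(** Register [r] is the position of the head on work tape [r.+1], whose only
    mark, written by the first step, is at cell 0 and serves as zero test. *)
Definition machine_delta (q : option (option (point c)))
    (a : {ffun 'I_K.+1 -> option bool}) :
    option (option (point c)) * {ffun 'I_K.+1 -> option bool * move} :=
  match q with
  | None => (Some (Some (entry c)),
             [ffun j => (if j == ord0 then a j else Some true, MoveN)])
  | Some None => (Some None, [ffun j => (a j, MoveN)])
  | Some (Some q) =>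
    let y := next q (fun r => a (inord r.+1) == Some true) (a ord0 == Some true)
    in (Some y.1,
        [ffun j => (a j,
           if j == ord0 then (if y.2.2 then MoveR else MoveN)
           else if y.2.1 is Some (r, b) then
             (if nat_of_ord j == r.+1 then (if b then MoveR else MoveL)
              else MoveN)
           else MoveN)])
  end.

Definition machine : TM :=
  @MkTM K (option (option (point c))) None (Some None) machine_delta.

Definition tape (w : seq bool) (j : 'I_K.+1) (p : int) : option bool :=
  if j == ord0 then (if p is Posz i then onth w i else None)
  else if p == 0%R then Some true else None.

Definition simulates (w : seq bool) (x : control c) (y : tm_config machine) :=
  [/\ cfg_state y = Some x.1,
      forall j p, cfg_cell y j p = tape w j p,
      forall j : 'I_K.+1, j != ord0 -> cfg_head y j = Posz (x.2.1 j.-1)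
    & exists2 p : nat, cfg_head y ord0 = Posz p & x.2.2 = drop p w].

Lemma ohead_drop (w : seq bool) p : ohead (drop p w) = onth w p.
Proof. by elim: w p => [|a w IH] [|p] //=; rewrite drop0. Qed.

Lemma simulates_start w :
  simulates w (start c (fun=> 0, w)) (@tm_step machine (tm_init machine w)).
Proof.
split=> //= [j p|j jn0|]; rewrite ?ffunE //=; last by exists 0; rewrite ?drop0.
rewrite /tape; have [->|pn0] := eqVneq p 0%R; have [_|jn0] := eqVneq j ord0.
- by case: w.
- by [].
- by [].
by case: p pn0.
Qed.

Lemma simulates_step w x y : simulates w x y ->
  simulates w (mstep x) (@tm_step machine y).
Proof.
case: y => q cell head; case: x => o [s v] [/= -> Hc Hh [p Hp Hv]] /=.
case: o => [o|]; last first.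
  split=> //= [j i|j jn0|]; rewrite ?ffunE /=; last by exists p.
    by rewrite -Hc; case: eqP => // ->.
  exact: Hh.
rewrite /mstep /tm_step /=.
set a := [ffun j => cell j (head j)].
have -> : next o (fun r => a (inord r.+1) == Some true) (a ord0 == Some true)
        = next o (fun r => s r == 0) (ohead v == Some true).
  have -> : a ord0 = ohead v by rewrite ffunE Hp Hc /tape /= Hv ohead_drop.
  apply: next_ext => r /regsK rK.
  have jE : (inord r.+1 : 'I_K.+1) = r.+1 :> nat by rewrite inordK.
  have jn0 : (inord r.+1 : 'I_K.+1) != ord0 by rewrite -val_eqE /= jE.
  by rewrite ffunE Hc (Hh _ jn0) /tape (negPf jn0) jE; case: (s r).
set b := ohead v == _; case E: (next o _ b) => [o' [op adv]] /=.
split=> //= [j i|j jn0|]; rewrite ?ffunE /=.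
- by rewrite -Hc; case: eqP => // ->.
- rewrite (negPf jn0) /effect Hh //; case: op E => [[r d]|] E //=.
  have jr : (nat_of_ord j == r.+1) = (j.-1 == r).
    by move: jn0; rewrite -val_eqE /=; case: (nat_of_ord j).
  rewrite jr /upd; case: d E => E; case: eqP => [->|_] //=.
    by rewrite -PoszD addn1.
  have /= := next_dec (congr1 (fun u => u.2.1) E).
  by case: (s r) => // n _; rewrite -[n.+1]addn1 PoszD GRing.addrK addn1.
rewrite Hp; case: adv {E} => /=; last by exists p.
by exists p.+1; rewrite -?PoszD ?addn1 // Hv -drop1 drop_drop add1n.
Qed.

(** The first step of the machine only writes the marks, hence the shift by one
    between the two runs. *)
Lemma machine_halts w :
  tm_halts machine w <->
  exists n, (iter n (@mstep c) (start c (fun=> 0, w))).1 = None.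
Proof.
have sim n : simulates w (iter n (@mstep c) (start c (fun=> 0, w)))
                         (iter n.+1 (@tm_step machine) (tm_init machine w)).
  by elim: n => [|n IH]; [exact: simulates_start | exact: simulates_step].
split=> [[[//|n] H]|[n H]].
  by exists n; case: (sim n) => E _ _ _; move: E; rewrite H => -[].
by exists n.+1; case: (sim n) => -> _ _ _; rewrite H.
Qed.

End Machine.

(** * Recursively enumerable sets of numbers *)

(** These are the projections of primitive recursive sets: [B] codes a witness of
    membership, and the value 0 confirms it. *)
Definition reN (P : nat -> Prop) : Prop :=
  exists e : prf, forall v, P v <-> exists B, pev e (npair v B) = 0.

(** The input arrives entry by entry, hence the left-nested code. *)
Definition tuple_code (v : seq nat) : nat := foldl npair 0 v.

Definition unary_word (v : seq nat) : seq bool :=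
  flatten [seq rcons (nseq k true) false | k <- v].

Fixpoint read_input (m : nat) : cmd :=
  if m is m'.+1 then Seq (Seq (Read 1) (Pair 0 1 2)) (read_input m') else Clear 1.

Lemma exec_read_input v a :
  exec (read_input (size v)) (upd (fun=> 0) 0 a, unary_word v)
       (upd (fun=> 0) 0 (foldl npair a v), [::]).
Proof.
elim: v a => [|k v IH] a /=.
  by apply: (exec_eq (exec_clear _ _ _)); upd_cases.
apply: ESeq (IH _); rewrite /unary_word /= cat_rcons.
apply: ESeq (ERead _ _ _ _) _.
by apply: (exec_eq (exec_pair _ _ _ _ _ _)) => //; upd_cases.
Qed.

(** Register 0 holds the input, register 1 the witness under examination and
    register 2 the result of its examination. *)
Definition test (e : prf) : cmd :=
  Seq (Clear 2) (Seq (Copy 0 2 4) (Seq (Copy 1 3 4)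
    (Seq (Pair 2 3 4) (compile e 2 3)))).

Definition tested (e : prf) (v B : nat) : nat -> nat :=
  upd (upd (upd (fun=> 0) 0 v) 1 B) 2 (pev e (npair v B)).

Lemma exec_test e v B x w :
  exec (test e) (upd (upd (upd (fun=> 0) 0 v) 1 B) 2 x, w) (tested e v B, w).
Proof.
apply: ESeq (exec_clear _ _ _) _.
do 2 (apply: ESeq (exec_copy _ _ _ _ _) _ => //).
apply: ESeq (exec_pair _ _ _ _ _ _) _ => //.
apply: (exec_eq (compileP _ _ _ _)) => //.
  by case=> [|[|[|[|i]]]].
by rewrite /tested; case=> [|[|[|[|i]]]].
Qed.

Definition search (e : prf) : cmd := While 2 (Seq (Inc 1) (test e)).

Lemma exec_search_body e v B w :
  exec (Seq (Inc 1) (test e)) (tested e v B, w) (tested e v B.+1, w).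
Proof.
apply: ESeq (EInc _ _ _) _.
have -> : upd (tested e v B) 1 (tested e v B 1).+1
   = upd (upd (upd (fun=> 0) 0 v) 1 B.+1) 2 (pev e (npair v B)).
  by apply: funext; rewrite /tested; upd_tac.
exact: exec_test.
Qed.

Lemma exec_search e v w B : pev e (npair v B) = 0 ->
  exists B', exec (search e) (tested e v 0, w) (tested e v B', w).
Proof.
move=> B0; suff H n : n <= B ->
    exists B', exec (search e) (tested e v (B - n), w) (tested e v B', w).
  by have := H B (leqnn B); rewrite subnn.
elim: n => [_|n IH ltnB]; first by exists B; rewrite subn0; apply: EWhile0.
have [z|nz] := eqVneq (pev e (npair v (B - n.+1))) 0.
  by exists (B - n.+1); apply: EWhile0.
have [B' HB] := IH (ltnW ltnB); exists B'.
have nz' : tested e v (B - n.+1) 2 <> 0 by exact/eqP.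
apply: EWhileS nz' _ HB.
rewrite (_ : B - n = (B - n.+1).+1); [exact: exec_search_body | lia].
Qed.

(** The machine tries the witnesses one after the other. It stops exactly when one
    of them is confirmed. *)
Theorem reN_machine (P : nat -> Prop) (m : nat) : reN P ->
  exists T : TM, forall v, size v = m ->
    (tm_halts T (unary_word v) <-> P (tuple_code v)).
Proof.
case=> e He; pose pre := Seq (read_input m) (test e).
pose main := Seq pre (search e).
have regsK : {in regs main, forall r, r < (\max_(r <- regs main) r).+1}.
  by move=> r rin; rewrite ltnS; exact: (leq_bigmax_seq (F := id)).
exists (machine main (\max_(r <- regs main) r).+1) => v sv.
rewrite (machine_halts regsK) He; set a := tuple_code v.
have Hpre : exec pre (fun=> 0, unary_word v) (tested e a 0, [::]).
  have -> : (fun=> 0) = upd (fun=> 0) 0 0 by apply: funext; upd_tac.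
  rewrite /pre -sv; apply: ESeq (exec_read_input _ _) _.
  rewrite -/(tuple_code v) -/a.
  have -> : upd (fun=> 0) 0 a
      = upd (upd (upd (fun=> 0) 0 a) 1 0) 2 0.
    by clearbody a; apply: funext; upd_tac.
  exact: exec_test.
split=> [[n Hn]|[B /(exec_search [::]) [B' HB]]]; last first.
  have [n Hn] := exec_run (ESeq Hpre HB).
  by exists n; rewrite Hn.
apply: contrapT => noB.
have nz B : tested e a B 2 <> 0 by move=> z; apply: noB; exists B.
(* Without a witness the loop is entered again and again, and a machine that has
   stopped would no longer be at the loop test. *)
have late B : exists2 k, B <= k & iter k (@mstep main)
    (start main (fun=> 0, unary_word v)) = (Some (inr None), (tested e a B, [::])).
  elim: B => [|B [k leB Hk]].
    have [k Hk] := exec_run Hpre.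
    by have [k' Hk'] := run_seql (search e) Hk; exists k'.
  have [k' Hk'] := run_loop (nz B) (exec_search_body e a B [::]).
  exists (k'.+1 + k); first lia.
  apply: (iter_trans Hk).
  have := run_seqr pre k'.+1 (start (search e) (tested e a B, [::])).
  by rewrite Hk'.
have [k lenk Hk] := late n.
move: Hk; rewrite -(subnK lenk) iterD.
by case: (iter n _ _) Hn => o y /= ->; rewrite mstep_exit.
Qed.

(** * Computability on named types *)

(** Different objects may share a name, and not every number need be a name. This
    allows parameter spaces such as that of all descriptions of real numbers,
    where the name is what a machine sees. Quantification over witnesses, on the
    other hand, requires types in bijection with the natural numbers. *)
Class named (T : Type) := nm : T -> nat.

Class coded (T : Type) (nT : named T) := Coded {
  dec : nat -> T;
  decK : forall n, nm (dec n) = n;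
  nm_inj : injective (nm : T -> nat) }.

#[global] Instance named_nat : named nat := id.

#[global] Instance named_pair (T U : Type) (nT : named T) (nU : named U) :
  named (T * U) := fun p => npair (nm p.1) (nm p.2).

#[global] Instance named_seq (T : Type) (nT : named T) : named (seq T) :=
  foldr (fun x c => (npair (nm x) c).+1) 0.

#[global] Instance coded_nat : coded named_nat.
Proof. by exists id. Defined.

Lemma npair_inj x y x' y' : npair x y = npair x' y' -> x = x' /\ y = y'.
Proof. by move=> /(congr1 unpair); rewrite !npairK => -[]. Qed.

#[global] Instance coded_pair (T U : Type) (nT : named T) (nU : named U)
  (cT : coded nT) (cU : coded nU) : coded (named_pair nT nU).
Proof.
exists (fun n => (dec (unpair n).1, dec (unpair n).2)) => [n|[x y] [x' y']].
  by rewrite {1}/nm /named_pair /= !decK unpairK.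
by case/npair_inj => /(@nm_inj _ _ cT) /= -> /(@nm_inj _ _ cU) /= ->.
Defined.

#[global] Instance coded_seq (T : Type) (nT : named T) (cT : coded nT) :
  coded (named_seq nT).
Proof.
have surj n : exists l : seq T, nm l = n.
  elim/ltn_ind: n => -[|n] IH; first by exists [::].
  have [|l El] := IH (unpair n).2; first by rewrite ltnS -{2}[n]unpairK leq_addl.
  exists (dec (unpair n).1 :: l).
  by rewrite /nm /= decK -/(nm l) El unpairK.
exists (fun n => projT1 (cid (surj n))) => [n|]; first by case: cid.
elim=> [|x l IH] [|x' l'] //= [] /npair_inj [/(@nm_inj _ _ cT) -> E].
by rewrite (IH l' E).
Defined.

Definition comp (T U : Type) (nT : named T) (nU : named U) (f : T -> U) : Prop :=
  exists e : prf, forall t, nm (f t) = pev e (nm t).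
Arguments comp {T U nT nU} f.

Section Comp.
Context {T U V : Type} {nT : named T} {nU : named U} {nV : named V}.

Lemma comp_ext (f g : T -> U) : f =1 g -> comp f -> comp g.
Proof. by move=> fg [e He]; exists e => t; rewrite -fg. Qed.

Lemma comp_id : comp (fun t : T => t).
Proof.
by exists (PPair PFst PSnd) => t /=; rewrite unpairK.
Qed.

Lemma comp_comp (f : U -> V) (g : T -> U) :
  comp f -> comp g -> comp (fun t => f (g t)).
Proof. by move=> [e He] [d Hd]; exists (PComp e d) => t; rewrite He Hd. Qed.

Lemma comp_const (c : U) : comp (fun _ : T => c).
Proof.
exists (iter (nm c) (PComp PSucc) PZero) => t.
by elim: (nm c) => //= n <-.
Qed.

Lemma comp_pair (f : T -> U) (g : T -> V) :
  comp f -> comp g -> comp (fun t => (f t, g t)).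
Proof.
by move=> [e He] [d Hd]; exists (PPair e d) => t; rewrite /= -He -Hd.
Qed.

Lemma comp_fst (f : T -> U * V) : comp f -> comp (fun t => (f t).1).
Proof.
move=> [e He]; exists (PComp PFst e) => t.
by rewrite /= -He {2}/nm /named_pair npairK.
Qed.

Lemma comp_snd (f : T -> U * V) : comp f -> comp (fun t => (f t).2).
Proof.
move=> [e He]; exists (PComp PSnd e) => t.
by rewrite /= -He {2}/nm /named_pair npairK.
Qed.

Lemma comp_iter (f : U -> U) (g : T -> nat) (h : T -> U) :
  comp f -> comp g -> comp h -> comp (fun t => iter (g t) f (h t)).
Proof.
move=> [e He] [d Hd] [c Hc]; exists (PComp (PIter e) (PPair c d)) => t /=.
rewrite -Hc -Hd npairK /= /nm /named_nat; elim: (g t) => //= n IH.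
by rewrite -IH; exact: He.
Qed.

Lemma comp_S (f : T -> nat) : comp f -> comp (fun t => (f t).+1).
Proof. by move=> [e He]; exists (PComp PSucc e) => t; rewrite /= -He. Qed.

Lemma comp_unpair (f : T -> nat) : comp f -> comp (fun t => unpair (f t)).
Proof.
move=> [e He]; exists e => t.
by rewrite -He /nm /named_pair /= /nm /named_nat unpairK.
Qed.

Lemma comp_dec (cU : coded nU) (f : T -> nat) :
  comp f -> comp (fun t => dec (f t) : U).
Proof. by move=> [e He]; exists e => t; rewrite -He decK. Qed.

Lemma comp_cons (f : T -> U) (g : T -> seq U) :
  comp f -> comp g -> comp (fun t => f t :: g t).
Proof.
move=> [e He] [d Hd]; exists (PComp PSucc (PPair e d)) => t.
by rewrite /= -He -Hd.
Qed.

End Comp.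

Section Arithmetic.
Context {T : Type} {nT : named T}.
Variables (f g : T -> nat).
Hypotheses (cf : comp f) (cg : comp g).

Lemma comp_add : comp (fun t => f t + g t).
Proof.
apply: comp_ext (comp_iter (comp_S (@comp_id nat _)) cg cf) => t.
by elim: (g t) => [|n IH]; rewrite ?addn0 // addnS -IH.
Qed.

Lemma comp_pred : comp (fun t => (f t).-1).
Proof.
pose h (p : nat * nat) := (p.2, p.2.+1).
have ch : comp h.
  by apply: comp_pair; [|apply: comp_S]; apply: comp_snd; exact: comp_id.
apply: comp_ext (comp_fst (comp_iter ch cf (comp_const (0, 0)))) => t.
suff -> : iter (f t) h (0, 0) = ((f t).-1, f t) by [].
by elim: (f t) => //= n ->.
Qed.

End Arithmetic.

Section Arithmetic.
Context {T : Type} {nT : named T}.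
Variables (f g : T -> nat).
Hypotheses (cf : comp f) (cg : comp g).

Lemma comp_sub : comp (fun t => f t - g t).
Proof.
apply: comp_ext (comp_iter (comp_pred (@comp_id nat _)) cg cf) => t.
by elim: (g t) => [|n IH]; rewrite ?subn0 //= IH subnS.
Qed.

Lemma comp_mul : comp (fun t => f t * g t).
Proof.
pose h (p : nat * nat) := (p.1, p.2 + p.1).
have ch : comp h.
  apply: comp_pair; first exact/comp_fst/comp_id.
  by apply: comp_add; [apply: comp_snd | apply: comp_fst]; exact: comp_id.
apply: comp_ext (comp_snd (comp_iter ch cg (comp_pair cf (comp_const 0)))) => t.
suff -> : iter (g t) h (f t, 0) = (f t, f t * g t) by [].
by elim: (g t) => [|n /= ->]; rewrite ?muln0 // /h /= mulnS addnC.
Qed.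

End Arithmetic.

(** Lists are coded by iterated pairing, and the code of the default value is 0, so
    that decoding the empty list yields it as well. *)
Lemma comp_nth {T U : Type} {nT : named T} {nU : named U} (x0 : U)
    (f : T -> seq U) i :
  nm x0 = 0 -> comp f -> comp (fun t => nth x0 (f t) i).
Proof.
move=> x00 cf.
have c1 : comp (fun l : seq U => unpair (nm l).-1).
  by apply/comp_unpair/comp_pred; exists (PPair PFst PSnd) => l /=;
    rewrite unpairK.
have [eh Hh] : comp (fun l : seq U => head x0 l).
  have [e He] := comp_fst c1; exists e => -[|x l]; rewrite -He ?x00 //.
  by rewrite {3}/nm /= npairK.
have [eb Hb] : comp (fun l : seq U => behead l).
  have [e He] := comp_snd c1; exists e => -[|x l]; rewrite -He //.
  by rewrite {3}/nm /= npairK.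
elim: i f cf => [|i IH] f cf.
  apply: comp_ext (comp_comp _ cf); last by exists eh; exact: Hh.
  by move=> t; rewrite nth0.
apply: comp_ext (IH (fun t => behead (f t)) _) => [t|].
  by rewrite nth_behead.
by apply: comp_comp cf; exists eb.
Qed.

Lemma comp_map {T U I : Type} {nT : named T} {nU : named U} (f : I -> T -> U)
    (s : seq I) :
  (forall i, comp (f i)) -> comp (fun t => [seq f i t | i <- s]).
Proof.
move=> cf; elim: s => [|i s IH]; first exact: comp_const.
exact: comp_cons.
Qed.

(** * Recursively enumerable predicates *)

Definition re (T : Type) (nT : named T) (P : T -> Prop) : Prop :=
  exists e : prf, forall t, P t <-> exists B, pev e (npair (nm t) B) = 0.
Arguments re {T nT} P.

Section Re.
Context {T : Type} {nT : named T}.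
Implicit Types P Q : T -> Prop.

Lemma re_intro P (g : T * nat -> nat) :
  comp g -> (forall t, P t <-> exists B, g (t, B) = 0) -> re P.
Proof.
move=> [e He] H; exists e => t; rewrite H.
by split=> -[B HB]; exists B; [rewrite -[LHS](He (t, B)) | rewrite -HB;
  exact: (He (t, B))].
Qed.

Lemma re_elim P : re P ->
  exists2 g : T * nat -> nat, comp g & forall t, P t <-> exists B, g (t, B) = 0.
Proof.
move=> [e He]; exists (fun p => pev e (nm p)) => //.
by exists e.
Qed.

End Re.

Section ReClosure.
Context {T : Type} {nT : named T}.
Implicit Types P Q : T -> Prop.

Lemma re_iff P Q : (forall t, P t <-> Q t) -> re Q -> re P.
Proof. by move=> H [e He]; exists e => t; rewrite H. Qed.

Lemma re_const (A : Prop) : re (fun _ : T => A).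
Proof.
have [a|na] := pselect A.
  by apply: (re_intro (comp_const 0)) => t; split=> // _; exists 0.
by apply: (re_intro (comp_const 1)) => t; split=> // -[].
Qed.

Lemma re_comp (U : Type) {nU : named U} (P : U -> Prop) (f : T -> U) :
  comp f -> re P -> re (fun t => P (f t)).
Proof.
move=> cf /re_elim [g cg Hg].
apply: (re_intro (g := fun p => g (f p.1, p.2))) => [|t]; last exact: Hg.
apply: comp_comp cg _; apply: comp_pair.
  by apply: comp_comp cf _; exact/comp_fst/comp_id.
exact/comp_snd/comp_id.
Qed.

Lemma re_eq0 (f : T -> nat) : comp f -> re (fun t => f t = 0).
Proof.
move=> cf; apply: (re_intro (g := fun p => f p.1)) => [|t].
  by apply: comp_comp cf _; exact/comp_fst/comp_id.
by split=> [|[]//]; exists 0.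
Qed.

Lemma re_le (f g : T -> nat) : comp f -> comp g -> re (fun t => f t <= g t).
Proof.
move=> cf cg; apply: re_iff (re_eq0 (comp_sub cf cg)) => t.
by rewrite /leq; split=> /eqP.
Qed.

Lemma re_and P Q : re P -> re Q -> re (fun t => P t /\ Q t).
Proof.
move=> /re_elim [f cf Hf] /re_elim [g cg Hg].
pose h (p : T * nat) := f (p.1, (unpair p.2).1) + g (p.1, (unpair p.2).2).
apply: (re_intro (g := h)) => [|t].
  apply: comp_add; apply: comp_comp; try by [];
    (apply: comp_pair; first exact/comp_fst/comp_id).
    exact/comp_fst/comp_unpair/comp_snd/comp_id.
  exact/comp_snd/comp_unpair/comp_snd/comp_id.
rewrite Hf Hg /h /=; split=> [[[B HB] [C HC]]|[B /eqP]].
  by exists (npair B C); rewrite npairK /= HB HC.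
by rewrite addn_eq0 => /andP [/eqP ? /eqP ?]; split; eexists; eassumption.
Qed.

Lemma re_or P Q : re P -> re Q -> re (fun t => P t \/ Q t).
Proof.
move=> /re_elim [f cf Hf] /re_elim [g cg Hg].
apply: (re_intro (comp_mul cf cg)) => t; rewrite Hf Hg.
split=> [[[B HB]|[B HB]]|[B /eqP]].
- by exists B; rewrite HB.
- by exists B; rewrite HB muln0.
by rewrite muln_eq0 => /orP [] /eqP HB; [left | right]; exists B.
Qed.

(** The two witnesses, for the quantifier and for the predicate, form one. *)
Lemma re_ex (U : Type) {nU : named U} {cU : coded nU} (P : T -> U -> Prop) :
  re (fun p : T * U => P p.1 p.2) -> re (fun t => exists u, P t u).
Proof.
move=> /re_elim [f cf Hf].
apply: (re_intro (g := fun p => f ((p.1, dec (unpair p.2).1), (unpair p.2).2))).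
  apply: comp_comp cf _; apply: comp_pair.
    apply: comp_pair; first exact/comp_fst/comp_id.
    exact/comp_dec/comp_fst/comp_unpair/comp_snd/comp_id.
  exact/comp_snd/comp_unpair/comp_snd/comp_id.
move=> t; split=> [[u /(Hf (t, u)) [B HB]]|[B HB]].
  exists (npair (nm u) B); rewrite npairK /=.
  by rewrite (_ : dec (nm u) = u) //; apply: nm_inj; rewrite decK.
by exists (dec (unpair B).1); apply/(Hf (t, _)); eexists; exact: HB.
Qed.

Lemma re_eq (U : Type) {nU : named U} {cU : coded nU} (f g : T -> U) :
  comp f -> comp g -> re (fun t => f t = g t).
Proof.
move=> [e He] [d Hd].
have cn (h : T -> U) k : (forall t, nm (h t) = pev k (nm t)) ->
    comp (fun t => nm (h t)) by move=> H; exists k.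
apply: re_iff (re_and (re_le (cn _ _ He) (cn _ _ Hd))
                      (re_le (cn _ _ Hd) (cn _ _ He))) => t.
split=> [->//|[le1 le2]]; apply: nm_inj; apply/eqP.
by rewrite eqn_leq le1.
Qed.

Lemma re_all (I : Type) (P : I -> T -> Prop) (s : seq I) :
  (forall i, re (P i)) -> re (fun t => forall i, List.In i s -> P i t).
Proof.
move=> H; elim: s => [|i s IH]; first by apply: re_iff (re_const True).
apply: re_iff (re_and (H i) IH) => t; split=> [K|[Pi K] j /= [<-//|]].
  by split=> [|j Hj]; apply: K; [left | right].
exact: K.
Qed.

Lemma re_forall (I : finType) (P : I -> T -> Prop) :
  (forall i, re (P i)) -> re (fun t => forall i, P i t).
Proof.
move=> H; apply: re_iff (re_all (enum I) H) => t; split=> // K i.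
apply: K; have: i \in enum I by rewrite mem_enum.
by elim: (enum I) => //= j s IH; rewrite inE => /orP [/eqP ->|/IH]; tauto.
Qed.

End ReClosure.

(** ** Inductively defined predicates *)

Inductive star (T : Type) (S : T -> T -> Prop) : T -> T -> Prop :=
| Star0 x : star S x x
| StarS x y z : S x y -> star S y z -> star S x z.

Lemma comp_npair {T : Type} {nT : named T} (f g : T -> nat) :
  comp f -> comp g -> comp (fun t => npair (f t) (g t)).
Proof.
by move=> [e He] [d Hd]; exists (PPair e d) => t; rewrite /= -He -Hd.
Qed.

Lemma comp_nm {T U : Type} {nT : named T} {nU : named U} (f : T -> U) :
  comp f -> comp (fun t => nm (f t)).
Proof. by move=> [e He]; exists e. Qed.

(** The function is matched syntactically: unification up to conversion would
    unfold the codings. *)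
Ltac comp_step := lazymatch goal with
  | |- comp (fun t => t) => exact: comp_id
  | |- comp fst => exact: comp_fst comp_id
  | |- comp snd => exact: comp_snd comp_id
  | |- comp (fun _ => ?c) => exact: comp_const
  | |- comp (fun t => (@?f t).1) => refine (@comp_fst _ _ _ _ _ _ f _)
  | |- comp (fun t => (@?f t).2) => refine (@comp_snd _ _ _ _ _ _ f _)
  | |- comp (fun t => (@?f t, @?g t)) => refine (@comp_pair _ _ _ _ _ _ f g _ _)
  | |- comp (fun t => @?f t :: @?g t) => refine (@comp_cons _ _ _ _ f g _ _)
  | |- comp (fun t => (@?f t).+1) => refine (@comp_S _ _ f _)
  | |- comp (fun t => (@?f t).-1) => refine (@comp_pred _ _ f _)
  | |- comp (fun t => @?f t + @?g t) => refine (@comp_add _ _ f g _ _)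
  | |- comp (fun t => @?f t * @?g t) => refine (@comp_mul _ _ f g _ _)
  | |- comp (fun t => @?f t - @?g t) => refine (@comp_sub _ _ f g _ _)
  | |- comp (fun t => unpair (@?f t)) => refine (@comp_unpair _ _ f _)
  | |- comp (fun t => npair (@?f t) (@?g t)) => refine (@comp_npair _ _ f g _ _)
  | |- comp (fun t => nm (@?f t)) => refine (@comp_nm _ _ _ _ f _)
  | |- comp (fun t => dec (@?f t)) => refine (@comp_dec _ _ _ _ _ f _)
  end.

Ltac comp_tac := rewrite /=; repeat comp_step.

(** A path is presented as a stream of its successive states, each with a
    witness that the step leading to it is allowed; the failures are summed up
    along the path. *)
Lemma re_star (T : Type) {nT : named T} {cT : coded nT} (S : T -> T -> Prop) :
  re (fun p : T * T => S p.1 p.2) -> re (fun p : T * T => star S p.1 p.2).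
Proof.
move=> /re_elim [f cf Hf].
pose tgt (L : nat) : T := @dec T nT cT (unpair (unpair L).1).1.
pose wit (L : nat) := (unpair (unpair L).1).2.
pose h (p : T * nat * nat) : T * nat * nat :=
  (tgt p.1.2, (unpair p.1.2).2, p.2 + f ((p.1.1, tgt p.1.2), wit p.1.2)).
have ch : comp h.
  rewrite /h /tgt /wit; comp_tac.
  by apply: comp_comp cf _; comp_tac.
apply: (re_iff (Q := fun p : T * T => exists q : nat * nat,
  (iter q.1 h (p.1, q.2, 0)).1.1 = p.2 /\ (iter q.1 h (p.1, q.2, 0)).2 = 0)).
  case=> s t /=; split=> [|[[k L] /=]].
    elim=> {s t} [x|x y z Sxy _ [[k L] /= [E1 E2]]]; first by exists (0, 0).
    have [B HB] := (Hf (x, y)).1 Sxy.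
    exists (k.+1, npair (npair (nm y) B) L); rewrite !iterSr /h /= -/h.
    rewrite /tgt /wit !npairK /= (_ : dec (nm y) = y) ?HB //.
    by apply: nm_inj; rewrite decK.
  have accS n p : p.2 <= (iter n h p).2.
    by elim: n p => //= n IH p; apply: leq_trans (IH p) (leq_addr _ _).
  elim: k s L => [|k IH] s L; first by case=> /= -> _; exact: Star0.
  rewrite iterSr; set p1 := h _ => -[E1 E2].
  have := accS k p1; rewrite E2 leqn0 {1}/p1 {1}/h /= => /eqP F.
  have Ep : p1 = (tgt L, (unpair L).2, 0) by rewrite /p1 /h /= F.
  rewrite Ep in E1 E2; apply: (StarS (y := tgt L)); last exact: IH (conj E1 E2).
  by apply/(Hf (s, tgt L)); exists (wit L); rewrite -[LHS]add0n.
have c1 : comp (fun p : T * T * (nat * nat) => iter p.2.1 h (p.1.1, p.2.2, 0)).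
  by apply: comp_iter => //; comp_tac.
by apply: re_ex; apply: re_and; [apply: re_eq | apply: re_eq0]; comp_tac.
Qed.

(** Rules with two premises suffice for what follows: missing premises are
    replaced by a trivial judgement. *)
Inductive derivable (T : Type) (ax : T -> Prop) (rule : T -> T -> T -> Prop) :
    T -> Prop :=
| DAx t : ax t -> derivable ax rule t
| DRule t a b : rule t a b -> derivable ax rule a -> derivable ax rule b ->
    derivable ax rule t.

(** Derivability is reachability of the empty stack of open goals. *)
Lemma re_derivable (T : Type) {nT : named T} {cT : coded nT}
    (ax : T -> Prop) (rule : T -> T -> T -> Prop) :
  re ax -> re (fun p : T * T * T => rule p.1.1 p.1.2 p.2) ->
  re (derivable ax rule).
Proof.
move=> rax rrule.
pose S (l l' : seq T) := exists t r, l = t :: r /\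
  ((ax t /\ l' = r) \/ exists a b, rule t a b /\ l' = a :: b :: r).
have rS : re (fun p : seq T * seq T => S p.1 p.2).
  do 2![apply: re_ex]; apply: re_and; first by apply: re_eq; comp_tac.
  apply: re_or; first apply: re_and.
  - by apply: (re_comp (f := fun p : seq T * seq T * T * seq T => p.1.2)) rax;
      comp_tac.
  - by apply: re_eq; comp_tac.
  do 2![apply: re_ex]; apply: re_and; last by apply: re_eq; comp_tac.
  apply: (re_comp (f := fun p : seq T * seq T * T * seq T * T * T =>
    (p.1.1.1.2, p.1.2, p.2))) rrule; comp_tac.
apply: (re_iff (Q := fun t => star S [:: t] [::])) => [t|]; last first.
  apply: (re_comp (f := fun t : T => ([:: t], [::] : seq T))) (re_star rS).
  by comp_tac.
split=> [dt|].
  suff H r l : star S r l -> star S (t :: r) l by apply: H; exact: Star0.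
  elim: dt r l => {t} [t axt|t a b Hr _ IHa _ IHb] r l rl.
    by apply: StarS rl; exists t, r; split=> //; left.
  apply: StarS (IHa _ _ (IHb _ _ rl)).
  by exists t, r; split=> //; right; exists a, b.
move=> H; suff {H} K : forall s l, star S s l -> l = [::] ->
    forall u, List.In u s -> derivable ax rule u.
  by apply: (K _ _ H) => //; left.
move=> s l; elim=> {s l} [l -> //|s s' l].
case=> u [r [-> Hu]] _ IH l0 v /= [<-|vr].
  case: Hu => [[axu _]|[a [b [Hr Es]]]]; first exact: DAx.
  by apply: (DRule Hr); apply: (IH l0); rewrite Es; [left | right; left].
apply: (IH l0); case: Hu => [[_ ->] //|[a [b [_ ->]]]].
by right; right.
Qed.

(** * Evaluation of Goedel numbers *)

(** Determinism makes the values found by searching for a derivation the values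
    of the described sequences. *)
Lemma reval_det e v y y' : reval e v y -> reval e v y' -> y = y'.
Proof.
move=> H; elim: H y' => {e v y}.
- by move=> v y'; inversion 1.
- by move=> x y'; inversion 1.
- by move=> i v iv y'; inversion 1.
- move=> f gs v w y sw _ IHg _ IHf y'; inversion 1 as [| | |? ? ? w' ? sw' Hg Hf| | |].
  apply: IHf; rewrite (_ : w = w') //.
  apply: (eq_from_nth (x0 := 0)) => [|i]; first by rewrite sw sw'.
  by rewrite sw => ig; apply: IHg => //; exact: Hg.
- by move=> f g v y _ IH y'; inversion 1; apply: IH.
- move=> f g n v z y _ IHz _ IHy y'.
  inversion 1 as [| | | | |? ? ? ? z' ? Hz' Hy'|].
  by rewrite -(IHz _ Hz') in Hy'; apply: IHy.
move=> f v y u _ IHu _ IH0 y'; inversion 1 as [| | | | | |? ? ? u' Hu' H0'].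
case: (ltngtP y y') => // lt.
  by have := IH0 _ (Hu' _ lt).
by have := IHu _ lt _ H0'.
Qed.

Ltac re_step := lazymatch goal with
  | |- re (fun t => exists x, _) => apply: re_ex
  | |- re (fun t => _ /\ _) => apply: re_and
  | |- re (fun t => _ \/ _) => apply: re_or
  | |- re (fun t => _ = _) => apply: re_eq
  | |- re (fun t => is_true (_ <= _)) => apply: re_le
  end.

Ltac re_tac := repeat (re_step; rewrite /=); repeat comp_step.

(** The judgements [(1, c, v, y)], [(2, c, v, y)], [(3, i, v, y)] and
    [(4, c, v, y)] say: program [c] maps [v] to [y]; the programs in the list [c]
    map [v] to the entries of the list coded by [y]; [y] is entry [i] of [v];
    program [c] is positive at [i :: v] for all [i < y]. The tag 0 is left for a
    trivial judgement. *)
Definition judgement : Type := (nat * nat * seq nat * nat)%type.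

Definition trivially : judgement := (0, 0, [::], 0).

Definition eval_axiom (j : judgement) : Prop :=
  j = trivially \/
  (exists v, j = (1, npair 0 0, v, 0)) \/
  (exists x, j = (1, npair 1 0, [:: x], x.+1)) \/
  (exists v, j = (2, 0, v, 0)) \/
  (exists x v, j = (3, 0, x :: v, x)) \/
  (exists c v, j = (4, c, v, 0)).

(** The clauses of the evaluation relation that have premises, with the lists of
    premises of composition and minimisation unrolled by the judgements 2 to 4. *)
Definition eval_rule (j a b : judgement) : Prop :=
  (exists i v y, j = (1, npair 2 i, v, y) /\
     (a = (3, i, v, y) /\ b = trivially)) \/
  (exists c d v (w : seq nat) y, j = (1, npair 3 (npair c d), v, y) /\
     (a = (2, d, v, nm w) /\ b = (1, c, w, y))) \/
  (exists c d v z w, j = (2, (npair c d).+1, v, (npair z w).+1) /\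
     (a = (1, c, v, z) /\ b = (2, d, v, w))) \/
  (exists c d v y, j = (1, npair 4 (npair c d), 0 :: v, y) /\
     (a = (1, c, v, y) /\ b = trivially)) \/
  (exists c d n v z y, j = (1, npair 4 (npair c d), n.+1 :: v, y) /\
     (a = (1, npair 4 (npair c d), n :: v, z) /\ b = (1, d, [:: n, z & v], y))) \/
  (exists c v y, j = (1, npair 5 c, v, y) /\
     (a = (1, c, y :: v, 0) /\ b = (4, c, v, y))) \/
  (exists c v i z, j = (4, c, v, i.+1) /\
     (a = (4, c, v, i) /\ b = (1, c, i :: v, z.+1))) \/
  (exists i x v y, j = (3, i.+1, x :: v, y) /\
     (a = (3, i, v, y) /\ b = trivially)).

Definition evaluates (c : nat) (v : seq nat) (y : nat) : Prop :=
  derivable eval_axiom eval_rule (1, c, v, y).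

Lemma re_evaluates :
  re (fun p : nat * seq nat * nat => evaluates p.1.1 p.1.2 p.2).
Proof.
apply: (re_comp (P := derivable eval_axiom eval_rule)
  (f := fun p : nat * seq nat * nat => (1, p.1.1, p.1.2, p.2))).
  by comp_tac.
apply: re_derivable; first by rewrite /eval_axiom; re_tac.
by rewrite /eval_rule; re_tac.
Qed.

Definition list_code (gs : seq recf) : nat :=
  foldr (fun g c => (npair (gnum g) c).+1) 0 gs.

Definition judgement_holds (j : judgement) : Prop :=
  match j with
  | (1, c, v, y) => forall e, gnum e = c -> reval e v y
  | (2, c, v, y) => forall gs, list_code gs = c -> exists2 w : seq nat, nm w = y &
      size w = size gs /\
      forall i, i < size gs -> reval (nth RZero gs i) v (nth 0 w i)
  | (3, i, v, y) => i < size v /\ nth 0 v i = y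
  | (4, c, v, y) => forall e, gnum e = c ->
      forall i, i < y -> exists z, reval e (i :: v) z.+1
  | _ => True
  end.

(** A code determines the program, since pairing is injective and the leading
    components of the codes tell the constructors apart. *)
Lemma eval_sound j : derivable eval_axiom eval_rule j -> judgement_holds j.
Proof.
elim=> {j} [j|j a b]; rewrite /eval_axiom /eval_rule.
  case=> [->//|[[v ->]|[[x ->]|[[v ->]|[[x [v ->]]|[c [v ->]]]]]]] //=.
  - case=> [||i|f gs|f g|f] /= /npair_inj [] // _ _; exact: EvZero.
  - case=> [||i|f gs|f g|f] /= /npair_inj [] // _ _; exact: EvSucc.
  - by case=> // _; exists [::].
case=> [[i [v [y [-> [-> ->]]]]]|].
  move=> _ /= [iv <-] _ _; case=> [||i'|f gs|f g|f] /= /npair_inj [] // _ ->.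
  exact: EvProj.
case=> [[c [d [v [w [y [-> [-> ->]]]]]]]|].
  move=> _ /= IHa _ IHb; case=> [||i|f gs|f g|f] /= /npair_inj [] // _.
  move=> /npair_inj [/IHb Hf /IHa [w' /(@nm_inj _ _ (coded_seq coded_nat)) Ew [sw Hg]]].
  by subst w'; apply: EvComp Hf.
case=> [[c [d [v [z [w [-> [-> ->]]]]]]]|].
  move=> _ /= IHa _ IHb [//|g gs] /= [/npair_inj [/IHa Hg /IHb [w' <- [sw H]]]].
  exists (z :: w'); first by [].
  by split=> [|[|i]] /=; [rewrite sw | move=> _; exact: Hg | exact: H].
case=> [[c [d [v [y [-> [-> ->]]]]]]|].
  move=> _ /= IHa _ _; case=> [||i|f gs|f g|f] /= /npair_inj [] // _.
  by move=> /npair_inj [/IHa Hf _]; exact: EvPrec0.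
case=> [[c [d [n [v [z [y [-> [-> ->]]]]]]]]|].
  move=> _ /= IHa _ IHb; case=> [||i|f gs|f g|f] E; move: (E);
    move=> /= /npair_inj [] // _ /npair_inj [_ /IHb Hg].
  by apply: EvPrecS Hg; apply: IHa.
case=> [[c [v [y [-> [-> ->]]]]]|].
  move=> _ /= IHa _ IHb; case=> [||i|f gs|f g|f] /= /npair_inj [] // _ E.
  have H i : exists z, i < y -> reval f (i :: v) z.+1.
    have [iy|] := ltnP i y; last by exists 0.
    by have [z Hz] := IHb f E i iy; exists z.
  by have [u Hu] := choice H; apply: (EvMin Hu); apply: IHa.
case=> [[c [v [i [z [-> [-> ->]]]]]]|].
  move=> _ /= IHa _ IHb e Ee k; rewrite ltnS leq_eqVlt => /orP [/eqP ->|].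
    by exists z; apply: IHb.
  exact: IHa.
by case=> [i [x [v [y [-> [-> ->]]]]]].
Qed.

Lemma derivable_nth i v : i < size v ->
  derivable eval_axiom eval_rule (3, i, v, nth 0 v i).
Proof.
elim: v i => [//|x v IH] [|i] /= iv.
  by apply: DAx; do 4!right; left; exists x, v.
apply: (DRule (a := (3, i, v, nth 0 v i)) (b := trivially)); last 1 first.
- by apply: DAx; left.
- by do 7!right; exists i, x, v, (nth 0 v i).
exact: IH.
Qed.

Lemma eval_complete e v y : reval e v y -> evaluates (gnum e) v y.
Proof.
have triv : derivable eval_axiom eval_rule trivially by apply: DAx; left.
elim=> {e v y} [v|x|i v iv|f gs v w y sw _ IHg _ IHf|f g v y _ IH
               |f g n v z y _ IHz _ IHy|f v y u _ IHu _ IH0]; rewrite /evaluates.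
- by apply: DAx; right; left; exists v.
- by apply: DAx; do 2!right; left; exists x.
- apply: (DRule _ (derivable_nth iv) triv).
  by left; exists i, v, (nth 0 v i).
- apply: (DRule (a := (2, list_code gs, v, nm w)) _ _ IHf).
    by right; left; exists (gnum f), (list_code gs), v, w, y.
  elim: gs w sw IHg {IHf} => [|g gs IHgs] [|z w] //= sw IHg.
    by apply: DAx; do 3!right; left; exists v.
  apply: (DRule (a := (1, gnum g, v, z)) (b := (2, list_code gs, v, nm w))).
  + by do 2!right; left; exists (gnum g), (list_code gs), v, z, (nm w).
  + exact: (IHg 0).
  apply: IHgs => [|i ig]; first by case: sw.
  exact: (IHg i.+1).
- apply: (DRule _ IH triv).
  by do 3!right; left; exists (gnum f), (gnum g), v, y.
- apply: (DRule _ IHz IHy).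
  by do 4!right; left; exists (gnum f), (gnum g), n, v, z, y.
apply: (DRule (b := (4, gnum f, v, y)) _ IH0).
  by do 5!right; left; exists (gnum f), v, y.
elim: y IHu {IH0} => [|y IH] IHu.
  by apply: DAx; do 5!right; exists (gnum f), v.
apply: (DRule _ (IH _) (IHu y _)) => // [|i iy]; last by apply: IHu; rewrite ltnW.
by do 6!right; left; exists (gnum f), v, y, (u y).
Qed.

Lemma evaluatesP e v y : evaluates (gnum e) v y <-> reval e v y.
Proof.
by split=> [/eval_sound /= H|]; [exact: H | exact: eval_complete].
Qed.

Local Open Scope ring_scope.

(** * Real-valued functions with recursively enumerable cuts *)

(** Codes of rational numbers: [(a, b, c)] stands for [(a - b) / c.+1]. Every
    triple is a code, and the ring operations are polynomial in the entries. *)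
Notation frac := (nat * nat * nat)%type.

Definition qadd (p q : frac) : frac :=
  (p.1.1 * q.2.+1 + q.1.1 * p.2.+1, p.1.2 * q.2.+1 + q.1.2 * p.2.+1,
   p.2 * q.2 + p.2 + q.2)%N.

Definition qopp (p : frac) : frac := (p.1.2, p.1.1, p.2).

Definition qmul (p q : frac) : frac :=
  (p.1.1 * q.1.1 + p.1.2 * q.1.2, p.1.1 * q.1.2 + p.1.2 * q.1.1,
   p.2 * q.2 + p.2 + q.2)%N.

Definition qinvS (n : nat) : frac := (1, 0, n)%N.

Definition qnat (n : nat) : frac := (n, 0, 0)%N.

Definition qlt (p q : frac) : bool :=
  (p.1.1 * q.2.+1 + q.1.2 * p.2.+1 < q.1.1 * p.2.+1 + p.1.2 * q.2.+1)%N.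

Section CompFrac.
Context {T : Type} {nT : named T}.
Variables f g : T -> frac.
Hypotheses (cf : comp f) (cg : comp g).

Lemma comp_qadd : comp (fun t => qadd (f t) (g t)).
Proof. by rewrite /qadd; comp_tac. Qed.

Lemma comp_qmul : comp (fun t => qmul (f t) (g t)).
Proof. by rewrite /qmul; comp_tac. Qed.

Lemma comp_qopp : comp (fun t => qopp (f t)).
Proof. by rewrite /qopp; comp_tac. Qed.

Lemma re_qlt : re (fun t => qlt (f t) (g t)).
Proof. by rewrite /qlt; apply: re_le; comp_tac. Qed.

End CompFrac.

Ltac qcomp_step := lazymatch goal with
  | H : comp ?f |- comp ?f => exact: H
  | H : comp ?f |- comp (fun t => ?f (@?g t)) => apply: (comp_comp H)
  | |- comp (fun t => qadd (@?f t) (@?g t)) => refine (@comp_qadd _ _ f g _ _)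
  | |- comp (fun t => qmul (@?f t) (@?g t)) => refine (@comp_qmul _ _ f g _ _)
  | |- comp (fun t => qopp (@?f t)) => refine (@comp_qopp _ _ f _)
  | |- comp (fun t => qinvS (@?f t)) => rewrite /qinvS
  | |- comp (fun t => qnat (@?f t)) => rewrite /qnat
  | |- _ => comp_step
  end.

Ltac qcomp := rewrite /=; repeat qcomp_step.

Section Cuts.
Variable R : realType.

Definition qv (q : frac) : R := (q.1.1%:R - q.1.2%:R) / q.2.+1%:R.

Lemma qvD p q : qv (qadd p q) = qv p + qv q.
Proof.
case: p q => [[a b] c] [[a' b'] c']; rewrite /qv /=.
have -> : (c * c' + c + c').+1 = (c.+1 * c'.+1)%N by lia.
have := pnatr_eq0 R c.+1; have := pnatr_eq0 R c'.+1.
rewrite !natrD !natrM; move: c.+1%:R c'.+1%:R => u v /negbT n1 /negbT n2.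
by field; rewrite n1 n2.
Qed.

Lemma qvM p q : qv (qmul p q) = qv p * qv q.
Proof.
case: p q => [[a b] c] [[a' b'] c']; rewrite /qv /=.
have -> : (c * c' + c + c').+1 = (c.+1 * c'.+1)%N by lia.
have := pnatr_eq0 R c.+1; have := pnatr_eq0 R c'.+1.
rewrite !natrD !natrM; move: c.+1%:R c'.+1%:R => u v /negbT n1 /negbT n2.
by field; rewrite n1 n2.
Qed.

Lemma qvN p : qv (qopp p) = - qv p.
Proof. by rewrite /qv /= -mulNr opprB. Qed.

Lemma qv_nat n : qv (qnat n) = n%:R.
Proof. by rewrite /qv /= subr0 divr1. Qed.

Lemma qv_invS n : qv (qinvS n) = n.+1%:R^-1.
Proof. by rewrite /qv /= subr0 div1r. Qed.

Lemma qltE p q : qlt p q = (qv p < qv q).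
Proof.
case: p q => [[a b] c] [[a' b'] c']; rewrite /qv /qlt /=.
rewrite ltr_pdivrMr ?ltr0n // mulrAC ltr_pdivlMr ?ltr0n //.
rewrite -subr_gt0 -(ltr_nat R) -[in LHS]subr_gt0 !natrD !natrM.
by congr (0 < _); ring.
Qed.

Lemma qv_dense (x y : R) : x < y -> exists q, x < qv q < y.
Proof.
move=> /rat_in_itvoo [r]; rewrite in_itv /= => xry.
suff [q E] : exists q, ratr r = qv q by exists q; rewrite -E.
have dS : denq r = `|denq r|.-1.+1 :> int.
  by rewrite prednK ?absz_gt0 ?denq_neq0 // gez0_abs // ltW ?denq_gt0.
rewrite /ratr dS; case: (numq r) => a.
  by exists (a, 0, `|denq r|.-1)%N; rewrite /qv /= subr0.
by exists (0, a.+1, `|denq r|.-1)%N; rewrite /qv /= sub0r NegzE mulrNz.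
Qed.

Section Basic.
Context {T : Type} {nT : named T}.

Lemma re_qv_lt (f g : T -> frac) : comp f -> comp g ->
  re (fun t => qv (f t) < qv (g t)).
Proof.
by move=> cf cg; apply: re_iff (re_qlt cf cg) => t; rewrite qltE.
Qed.

(** Both cuts are presented uniformly in the parameter. Unlike Cauchy names, cuts
    need no modulus of convergence: each closure property below amounts to a
    criterion for the strict inequalities that involves rational witnesses. *)
Definition creal (x : T -> R) : Prop :=
  re (fun p : T * frac => qv p.2 < x p.1) /\
  re (fun p : T * frac => x p.1 < qv p.2).

Lemma creal_ext (x y : T -> R) : x =1 y -> creal x -> creal y.
Proof. by move=> /funext ->. Qed.

End Basic.

Section Closure.
Context {T : Type} {nT : named T}.
Implicit Types x y : T -> R.

Lemma creal_comp (U : Type) {nU : named U} (x : U -> R) (f : T -> U) :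
  creal x -> comp f -> creal (fun t => x (f t)).
Proof.
move=> [l u] cf; split.
  by apply: (re_comp (f := fun p : T * frac => (f p.1, p.2)) _ l); qcomp.
by apply: (re_comp (f := fun p : T * frac => (f p.1, p.2)) _ u); qcomp.
Qed.

Lemma re_gtq x (f : T -> frac) : creal x -> comp f -> re (fun t => qv (f t) < x t).
Proof.
move=> [l _] cf; apply: (re_comp (f := fun t => (t, f t)) _ l).
by qcomp.
Qed.

Lemma re_ltq x (f : T -> frac) : creal x -> comp f -> re (fun t => x t < qv (f t)).
Proof.
move=> [_ l] cf; apply: (re_comp (f := fun t => (t, f t)) _ l).
by qcomp.
Qed.

Lemma creal_qv (f : T -> frac) : comp f -> creal (fun t => qv (f t)).
Proof. by move=> cf; split; apply: re_qv_lt; qcomp. Qed.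

End Closure.

End Cuts.
Arguments qv {R} q.

Ltac creal_var := lazymatch goal with
  | H : creal ?x |- creal (fun t => ?x (@?f t)) =>
      refine (@creal_comp _ _ _ _ _ x f H _); qcomp
  end.

Section Field.
Context {R : realType} {T : Type} {nT : named T}.
Implicit Types x y : T -> R.

Lemma creal_lt x y : creal x -> creal y -> re (fun t => x t < y t).
Proof.
move=> cx cy; apply: (re_iff (Q := fun t => exists q, x t < qv q /\ qv q < y t)).
  move=> t; split=> [/qv_dense [q /andP []]|[q []]]; first by exists q.
  exact: lt_trans.
by apply: re_ex; apply: re_and; [case: cx | case: cy].
Qed.

Lemma creal_opp x : creal x -> creal (fun t => - x t).
Proof.
move=> cx; split; rewrite /=.
  apply: (re_iff (Q := fun p : T * frac => x p.1 < qv (qopp p.2))) => [p|].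
    by rewrite qvN ltrNr.
  by apply: re_ltq; [creal_var | qcomp].
apply: (re_iff (Q := fun p : T * frac => qv (qopp p.2) < x p.1)) => [p|].
  by rewrite qvN ltrNl.
by apply: re_gtq; [creal_var | qcomp].
Qed.

Lemma re_add_cut x y : creal x -> creal y ->
  re (fun p : T * frac => qv p.2 < x p.1 + y p.1).
Proof.
move=> cx cy.
apply: (re_iff (Q := fun p : T * frac => exists a b,
   qv a < x p.1 /\ (qv b < y p.1 /\ (qv p.2 : R) < qv (qadd a b)))) => [[t q] /=|].
  split=> [lt|[a [b [ax [bx]]]]]; last by rewrite qvD; lra.
  pose d := (x t + y t - qv q) / 2%:R.
  have [a /andP [a1 a2]] : exists a, x t - d < qv a < x t.
    by apply: qv_dense; rewrite /d; lra.
  have [b /andP [b1 b2]] : exists a, y t - d < qv a < y t.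
    by apply: qv_dense; rewrite /d; lra.
  by exists a, b; rewrite qvD; split=> //; split=> //; rewrite /d in a1 b1; lra.
do 2!apply: re_ex; apply: re_and; last apply: re_and.
- by apply: re_gtq; [creal_var | qcomp].
- by apply: re_gtq; [creal_var | qcomp].
by apply: re_qv_lt; qcomp.
Qed.

End Field.

Section Ring.
Context {R : realType} {T : Type} {nT : named T}.
Implicit Types x y : T -> R.

Lemma creal_add x y : creal x -> creal y -> creal (fun t => x t + y t).
Proof.
move=> cx cy; split; first exact: re_add_cut.
have := re_add_cut (creal_opp cx) (creal_opp cy).
move/(re_comp (f := fun p : T * frac => (p.1, qopp p.2))) => H.
apply: re_iff (H _) => [p|]; last by qcomp.
by rewrite /= qvN -opprD ltrN2.
Qed.

Lemma creal_sub x y : creal x -> creal y -> creal (fun t => x t - y t).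
Proof. by move=> cx cy; apply: creal_add => //; exact: creal_opp. Qed.

Lemma creal_const_nat n : creal (fun _ : T => n%:R : R).
Proof.
apply: (creal_ext (x := fun _ => qv (qnat n) : R)) => [t|]; first by rewrite qv_nat.
by apply: creal_qv; qcomp.
Qed.

(** A rational between [sqrt q] and [`|x t|] witnesses [q < x t ^+ 2], one between
    [`|x t|] and [sqrt q] the opposite inequality. *)
Lemma creal_sqr x : creal x -> creal (fun t => x t ^+ 2).
Proof.
move=> cx; split.
  apply: (re_iff (Q := fun p : T * frac => (qv p.2 : R) < qv (qnat 0) \/
    exists a, (qv (qnat 0) : R) < qv a /\ ((qv p.2 : R) < qv (qmul a a) /\
      (qv a < x p.1 \/ x p.1 < qv (qopp a))))).
    move=> [t q] /=; rewrite qv_nat; split=> [lt|[q0|[a [a0 [qa]]]]].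
    - have [q0|q0] := ltP (qv q) (0 : R); [by left | right].
      have sq : Num.sqrt (qv q) < `|x t|.
        by rewrite -sqrtr_sqr ltr_sqrt // (le_lt_trans q0).
      have [a /andP [a1 a2]] := qv_dense sq.
      have a0 : (0 : R) < qv a by rewrite (le_lt_trans _ a1) ?sqrtr_ge0.
      exists a; rewrite qvM qvN; split=> //; split.
        rewrite -[qv q]sqr_sqrtr // -expr2 ltr_pXn2r // ?nnegrE ?sqrtr_ge0 //.
        exact: ltW.
      by move: a2; rewrite lter_normr; case/orP => ?; [left | right; lra].
    - by rewrite (lt_le_trans q0) // sqr_ge0.
    rewrite qvM qvN in qa * => H; apply: (lt_trans qa).
    by rewrite expr2; case: H => H; nra.
  apply: re_or; first by apply: re_qv_lt; qcomp.
  apply: re_ex; do 2!(apply: re_and; first by apply: re_qv_lt; qcomp).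
  apply: re_or; [apply: re_gtq | apply: re_ltq]; by first [creal_var | qcomp].
apply: (re_iff (Q := fun p : T * frac => exists a, (qv (qmul a a) : R) < qv p.2 /\
   (x p.1 < qv a /\ qv (qopp a) < x p.1))).
  move=> [t q] /=; split=> [lt|[a []]]; last first.
    rewrite qvM qvN => qa [xa ax]; apply: le_lt_trans qa.
    by rewrite expr2; nra.
  have q0 : (0 : R) < qv q by rewrite (le_lt_trans _ lt) ?sqr_ge0.
  have sq : `|x t| < Num.sqrt (qv q) by rewrite -sqrtr_sqr ltr_sqrt.
  have [a /andP [a1 a2]] := qv_dense sq.
  have a0 : (0 : R) < qv a by rewrite (le_lt_trans _ a1).
  exists a; rewrite qvM qvN -[qv q]sqr_sqrtr ?ltW // -expr2.
  split; first by rewrite ltr_pXn2r // nnegrE ltW // sqrtr_gt0.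
  by move: a1; rewrite ltr_norml => /andP [].
apply: re_ex; apply: re_and; first by apply: re_qv_lt; qcomp.
apply: re_and; [apply: re_ltq | apply: re_gtq]; by first [creal_var | qcomp].
Qed.

End Ring.

Section Multiplication.
Context {R : realType} {T : Type} {nT : named T}.
Implicit Types x y : T -> R.

Lemma creal_quarter x : creal x -> creal (fun t => x t / 4%:R).
Proof.
have E q (z : R) : (qv q < z / 4%:R) = (qv (qmul (qnat 4) q) < z).
  by rewrite qvM qv_nat ltr_pdivlMr // mulrC.
have E' q (z : R) : (z / 4%:R < qv q) = (z < qv (qmul (qnat 4) q)).
  by rewrite qvM qv_nat ltr_pdivrMr // mulrC.
move=> cx; split.
  apply: re_iff (re_gtq (x := fun p : T * frac => x p.1)
                        (f := fun p => qmul (qnat 4) p.2) _ _) => [p||].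
  - by rewrite E.
  - by creal_var.
  by qcomp.
apply: re_iff (re_ltq (x := fun p : T * frac => x p.1)
                      (f := fun p => qmul (qnat 4) p.2) _ _) => [p||].
- by rewrite E'.
- by creal_var.
by qcomp.
Qed.

(** Polarisation reduces products to squares. *)
Lemma creal_mul x y : creal x -> creal y -> creal (fun t => x t * y t).
Proof.
move=> cx cy.
apply: (creal_ext (x := fun t => ((x t + y t) ^+ 2 - (x t - y t) ^+ 2) / 4%:R)).
  by move=> t; field.
apply: creal_quarter; apply: creal_sub; apply: creal_sqr.
  exact: creal_add.
exact: creal_sub.
Qed.

Lemma creal_sum (I : Type) (s : seq I) (P : pred I) (x : I -> T -> R) :
  (forall i, creal (x i)) -> creal (fun t => \sum_(i <- s | P i) x i t).
Proof.
move=> cx; elim: s => [|i s IH].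
  by apply: creal_ext (creal_const_nat 0) => t; rewrite big_nil.
case Pi: (P i); last by apply: creal_ext IH => t; rewrite big_cons Pi.
by apply: creal_ext (creal_add (cx i) IH) => t; rewrite big_cons Pi.
Qed.

End Multiplication.

Definition qpow (p : frac) (n : nat) : frac :=
  (iter n (fun s => (s.1, qmul s.1 s.2)) (p, qnat 1)).2.

Lemma qvX (R : realType) p n : qv (qpow p n) = qv p ^+ n :> R.
Proof.
suff -> : qpow p n = iter n (qmul p) (qnat 1).
  by elim: n => [|n IH] /=; rewrite ?qv_nat // qvM IH exprS.
rewrite /qpow; have [H1 H2] : let s := iter n (fun s => (s.1, qmul s.1 s.2))
   (p, qnat 1) in s.1 = p /\ s.2 = iter n (qmul p) (qnat 1).
  by elim: n => //= n [-> ->].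
exact: H2.
Qed.

Lemma comp_qpow {T : Type} {nT : named T} (f : T -> frac) (g : T -> nat) :
  comp f -> comp g -> comp (fun t => qpow (f t) (g t)).
Proof.
move=> cf cg; apply: comp_snd; apply: comp_iter => //.
  by qcomp.
by qcomp.
Qed.

Section Logarithm.
Variable R : realType.

Lemma bernoulli (u : R) n : 0 <= u <= 1 -> 1 - n%:R * u <= (1 - u) ^+ n.
Proof.
move=> /andP [u0 u1]; elim: n => [|n IH]; first by rewrite mul0r subr0.
have un : 0 <= n%:R * u by rewrite mulr_ge0.
have : (1 - n%:R * u) * (1 - u) <= (1 - u) ^+ n.+1.
  by rewrite exprSr ler_wpM2r // subr_ge0.
by apply: le_trans; rewrite -natr1; nra.
Qed.

Lemma expR_power_ge (v : R) m : 0 <= 1 + v / m.+1%:R ->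
  (1 + v / m.+1%:R) ^+ m.+1 <= expR v.
Proof.
move=> v0; rewrite -[v in leRHS](divfK (_ : m.+1%:R != 0)) ?pnatr_eq0 //.
by rewrite expRM_natr lerXn2r ?nnegrE ?expR_ge0 // expR_ge1Dx.
Qed.

(** Since [(1 - v/m) ^ m <= exp (- v)], the product of this power with
    [(1 + v/m) ^ m] bounds the convergence of the latter to [exp v]. *)
Lemma expR_power_lt (v y : R) : y < expR v ->
  exists m, 0 < 1 + v / m.+1%:R /\ y < (1 + v / m.+1%:R) ^+ m.+1.
Proof.
move=> yv; have e0 := expR_gt0 v.
pose K := `|v| + v ^+ 2 * expR v / (expR v - y).
have K0 : 0 <= v ^+ 2 * expR v / (expR v - y).
  apply: divr_ge0; last by rewrite subr_ge0 ltW.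
  by rewrite mulr_ge0 ?sqr_ge0 // ltW.
exists (Num.truncn K); have := truncnS_gt K.
move: (Num.truncn K).+1 => n; move Em: (n%:R : R) => m Km.
have mv : `|v| < m by rewrite (le_lt_trans _ Km) // lerDl.
have m0 : 0 < m by rewrite (le_lt_trans _ mv).
have vm : `|v / m| < 1 by rewrite normrM normfV (gtr0_norm m0) ltr_pdivrMr ?mul1r.
have [vm1 vm2] : -1 < v / m /\ v / m < 1 by apply/andP; rewrite -ltr_norml.
split; first lra.
have em : (1 - v / m) ^+ n <= expR (- v).
  have -> : - v = - (v / m) * n%:R by rewrite Em mulNr divfK // lt0r_neq0.
  rewrite expRM_natr lerXn2r ?nnegrE ?expR_ge0 //; first lra.
  by have := expR_ge1Dx (- (v / m)).
have b : 1 - v ^+ 2 / m <= (1 + v / m) ^+ n * (1 - v / m) ^+ n.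
  rewrite -exprMn (_ : (1 + v / m) * (1 - v / m) = 1 - (v / m) ^+ 2);
    last by ring.
  apply: le_trans (bernoulli n _); last first.
    by rewrite sqr_ge0 /= expr2; nra.
  rewrite Em (_ : m * (v / m) ^+ 2 = v ^+ 2 / m) //.
  by field; exact: lt0r_neq0.
have p0 : 0 < (1 + v / m) ^+ n by rewrite exprn_gt0 //; lra.
have : (1 - v ^+ 2 / m) * expR v <= (1 + v / m) ^+ n.
  have : 1 - v ^+ 2 / m <= (1 + v / m) ^+ n * expR (- v).
    by apply: le_trans b _; rewrite ler_pM2l.
  by move/(ler_wpM2r (ltW e0)); rewrite -[leRHS]mulrA -expRD addNr expR0 mulr1.
apply: lt_le_trans.
have : v ^+ 2 / m * expR v < expR v - y; last by lra.
rewrite mulrAC ltr_pdivrMr // [ltRHS]mulrC -ltr_pdivrMr ?subr_gt0 //.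
by rewrite (le_lt_trans _ Km) // lerDr.
Qed.

Context {T : Type} {nT : named T}.
Implicit Types x w : T -> R.

Definition qfactor (q : frac) (m : nat) : frac :=
  qadd (qnat 1) (qmul q (qinvS m)).

Lemma qv_factor q m : qv (qfactor q m) = 1 + qv q / m.+1%:R :> R.
Proof. by rewrite qvD qvM qv_nat qv_invS. Qed.

(** The powers [(1 + q/m) ^ m] with positive base converge to [exp q] from below;
    comparing [x] with one of them bounds [ln x] from above, and comparing [x]
    with the inverse of such a power of [- q] bounds it from below. *)
Lemma creal_ln x : (forall t, 0 < x t) -> creal x -> creal (fun t => ln (x t)).
Proof.
move=> x0 cx; split.
  apply: (re_iff (Q := fun p : T * frac => exists m,
    (qv (qnat 0) : R) < qv (qfactor (qopp p.2) m) /\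
    1%:R < x p.1 * qv (qpow (qfactor (qopp p.2) m) m.+1))).
    case=> t q /=; split=> [lt|[m [pos gt]]].
      have H : (x t)^-1 < expR (- qv q).
        rewrite expRN ltf_pV2 ?posrE ?expR_gt0 //.
        by rewrite -[ltRHS]lnK ?posrE // ltr_expR.
      have [m [pos lt1]] := expR_power_lt H; exists m.
      rewrite qv_nat qvX qv_factor qvN; split=> //.
      by rewrite mulrC -ltr_pdivrMr // div1r.
    rewrite qv_nat qvX qv_factor qvN in pos gt.
    rewrite -ltr_expR lnK ?posrE // -[ltLHS]mul1r -ltr_pdivlMr ?expR_gt0 //.
    rewrite -expRN; apply: lt_le_trans gt _; rewrite ler_pM2l //.
    by apply: expR_power_ge; exact: ltW.
  apply: re_ex; apply: re_and.
    by apply: re_qv_lt; rewrite /qfactor; qcomp.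
  apply: creal_lt; first exact: creal_const_nat.
  apply: creal_mul; first creal_var.
  by apply: creal_qv; apply: comp_qpow; rewrite /qfactor; qcomp.
apply: (re_iff (Q := fun p : T * frac => exists m,
    (qv (qnat 0) : R) < qv (qfactor p.2 m) /\
    x p.1 < qv (qpow (qfactor p.2 m) m.+1))).
  case=> t q /=; split=> [lt|[m [pos gt]]].
    have H : x t < expR (qv q) by rewrite -[x t]lnK ?posrE // ltr_expR.
    have [m [pos lt1]] := expR_power_lt H; exists m.
    by rewrite qv_nat qvX qv_factor.
  rewrite qv_nat qvX qv_factor in pos gt.
  rewrite -ltr_expR lnK ?posrE //; apply: lt_le_trans gt _.
  by apply: expR_power_ge; exact: ltW.
apply: re_ex; apply: re_and.
  by apply: re_qv_lt; rewrite /qfactor; qcomp.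
apply: re_ltq; first creal_var.
by apply: comp_qpow; rewrite /qfactor; qcomp.
Qed.

End Logarithm.

#[global] Instance named_sig (T : Type) (nT : named T) (D : T -> Prop) :
  named {t : T | D t} := fun u => nm (sval u).

Lemma comp_sval {T U : Type} {nT : named T} {nU : named U} {D : T -> Prop}
    (f : U -> {t : T | D t}) : comp f -> comp (fun u => sval (f u)).
Proof. by move=> [e He]; exists e. Qed.

(** On names of objects outside [D] the test for [P] has no meaning, so it counts
    only together with a confirmation of membership in [D]. *)
Lemma re_restrict {T : Type} {nT : named T} (D P : T -> Prop) :
  re D -> re (fun u : {t : T | D t} => P (sval u)) -> re (fun t => D t /\ P t).
Proof.
move=> reD [e He].
apply: (re_iff (Q := fun t => D t /\ exists B, pev e (npair (nm t) B) = 0)).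
  by move=> t; split=> -[Dt]; have := He (exist _ t Dt); rewrite /nm /= => ->.
by apply: re_and => //; exists e.
Qed.

Section Entropy.
Context {R : realType} {T : Type} {nT : named T}.
Implicit Types w : T -> R.

Lemma xlnx_ge (w : R) : 0 < w -> - (Num.sqrt w + Num.sqrt w) <= w * ln w.
Proof.
move=> w0; set s := Num.sqrt w; have s0 : 0 < s by rewrite sqrtr_gt0.
have -> : w = s ^+ 2 by rewrite sqr_sqrtr // ltW.
rewrite lnXn // mulr2n; have := ln_sublinear (x := s^-1); rewrite invr_gt0 s0.
move=> /(_ isT); rewrite lnV ?posrE // => H.
have : s * (- ln s) < 1 by rewrite -(divff (lt0r_neq0 s0)) ltr_pM2l.
by nra.
Qed.

(** Whether [w t] vanishes is not decidable. Near zero, where the logarithm is of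
    no use, [w * ln w] is bounded by [0] from above and by [- 2 * sqrt w] from
    below, and these bounds are used without knowing that [w t] is positive. *)
Lemma creal_xlnx w : (forall t, 0 <= w t) -> creal w ->
  creal (fun t => w t * ln (w t)).
Proof.
move=> w0 cw; pose D (p : T * frac) := (0 : R) < w p.1.
have reD : re D by apply: creal_lt; [exact: (creal_const_nat 0) | creal_var].
have cD : creal (fun u : {p | D p} => w (sval u).1 * ln (w (sval u).1)).
  have cwD : creal (fun u : {p | D p} => w (sval u).1).
    by apply: (creal_comp cw); exact/comp_fst/comp_sval/comp_id.
  by apply: creal_mul => //; apply: creal_ln cwD => -[].
have c2 : comp (fun u : {p | D p} => (sval u).2).
  exact/comp_snd/comp_sval/comp_id.
split.
  apply: (re_iff (Q := fun p : T * frac =>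
     (D p /\ qv p.2 < w p.1 * ln (w p.1)) \/
     ((qv p.2 : R) < qv (qnat 0) /\ w p.1 < qv p.2 ^+ 2 / 4%:R))).
    case=> t q; rewrite /D /= qv_nat; have := w0 t.
    rewrite le_eqVlt => /orP [/eqP <-|wt0].
      rewrite mul0r ltxx; split=> [q0|[[]|[]]] //; right; split=> //.
      by rewrite divr_gt0 // exprn_even_gt0 // ltr0_neq0.
    split=> [lt|[[]|[q0 wq]]] //; first by left.
    apply: lt_le_trans (xlnx_ge wt0).
    have : Num.sqrt (w t) < - qv q / 2%:R.
      have -> : - qv q / 2%:R = Num.sqrt (qv q ^+ 2 / 4%:R) :> R.
        rewrite (_ : qv q ^+ 2 / 4%:R = (- qv q / 2%:R) ^+ 2); last by field.
        by rewrite sqrtr_sqr ger0_norm // divr_ge0 //; lra.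
      by rewrite ltr_sqrt // (lt_trans wt0).
    by lra.
  apply: re_or; first by apply: (re_restrict reD); exact: re_gtq cD c2.
  apply: re_and; first by apply: re_qv_lt; qcomp.
  apply: creal_lt; first creal_var.
  by apply/creal_quarter/creal_sqr/creal_qv; qcomp.
apply: (re_iff (Q := fun p : T * frac =>
   (D p /\ w p.1 * ln (w p.1) < qv p.2) \/
   ((qv (qnat 0) : R) < qv p.2 /\ w p.1 < 1%:R))).
  case=> t q; rewrite /D /= qv_nat; have := w0 t.
  rewrite le_eqVlt => /orP [/eqP <-|wt0].
    by rewrite mul0r ltxx; split=> [q0|[[]|[]]] //; right.
  split=> [lt|[[]|[q0 w1]]] //; first by left.
  apply: le_lt_trans q0; rewrite pmulr_rle0 // ln_le0 //; exact: ltW.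
apply: re_or; first by apply: (re_restrict reD); exact: re_ltq cD c2.
apply: re_and; first by apply: re_qv_lt; qcomp.
by apply: creal_lt; [creal_var | exact: creal_const_nat].
Qed.

Lemma creal_lim (x : T -> R) (y : T * nat -> R) (C : nat) :
  creal y -> (forall t k, `|y (t, k) - x t| <= C%:R / k.+1%:R) -> creal x.
Proof.
move=> cy H.
have small (e : R) : 0 < e -> exists k, C%:R / k.+1%:R < e.
  move=> e0; exists (Num.truncn (C%:R / e)).
  rewrite ltr_pdivrMr ?ltr0n // mulrC -ltr_pdivrMr //; exact: truncnS_gt.
pose err k := qmul (qnat C) (qinvS k).
have errE k : qv (err k) = C%:R / k.+1%:R :> R by rewrite qvM qv_nat qv_invS.
have {}small (e : R) : 0 < e -> exists k, qv (err k) < e.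
  by move=> /small [k Hk]; exists k; rewrite errE.
have {}H t k : x t - qv (err k) <= y (t, k) <= x t + qv (err k).
  by rewrite errE -ler_distl.
split.
  apply: (re_iff (Q := fun p : T * frac => exists k,
     qv (qadd p.2 (err k)) < y (p.1, k))) => [[t q] /=|].
    split=> [lt|[k]]; last by rewrite qvD; have := H t k; move=> /andP [? ?]; lra.
    have [|k Hk] := small ((x t - qv q) / 2%:R); first by lra.
    by exists k; rewrite qvD; have := H t k; move=> /andP [? ?]; lra.
  apply: re_ex; apply: re_gtq; last by rewrite /err; qcomp.
  by apply: (creal_comp (f := fun p : T * frac * nat => (p.1.1, p.2)) cy); qcomp.
apply: (re_iff (Q := fun p : T * frac => exists k,
   y (p.1, k) < qv (qadd p.2 (qopp (err k))))) => [[t q] /=|].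
  split=> [lt|[k]]; last first.
    by rewrite qvD qvN; have := H t k; move=> /andP [? ?]; lra.
  have [|k Hk] := small ((qv q - x t) / 2%:R); first lra.
  by exists k; rewrite qvD qvN; have := H t k; move=> /andP [? ?]; lra.
apply: re_ex; apply: re_ltq; last by rewrite /err; qcomp.
by apply: (creal_comp (f := fun p : T * frac * nat => (p.1.1, p.2)) cy); qcomp.
Qed.

End Entropy.

(** * Channel capacity *)

Section Divergence.
Variables (R : realType) (J : finType).
Implicit Types p q : J -> R.

Definition kl p q : R := \sum_y p y * ln (p y / q y).

(** Gibbs' inequality, from [ln z <= z - 1]. *)
Lemma kl_ge0 p q : (forall y, 0 <= p y) -> (forall y, 0 <= q y) ->
  (forall y, q y = 0 -> p y = 0) -> \sum_y q y <= \sum_y p y -> 0 <= kl p q.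
Proof.
move=> p0 q0 ac le; apply: (@le_trans _ _ (\sum_y (p y - q y))).
  by rewrite big_split /= sumrN subr_ge0.
apply: ler_sum => y _; have := p0 y; rewrite le_eqVlt => /orP [/eqP <-|py].
  by rewrite mul0r sub0r oppr_le0.
have qy : 0 < q y.
  by rewrite lt0r q0 andbT; apply/eqP => /ac E; rewrite E ltxx in py.
have := @le_ln1Dx R (q y / p y - 1).
rewrite ltrBrDl subrr divr_gt0 // addrC subrK => /(_ isT).
rewrite -[p y / q y]invrK invf_div lnV ?posrE ?divr_gt0 // => H.
have : p y * ln (q y / p y) <= p y * (q y / p y - 1) by rewrite ler_pM2l.
rewrite mulrBr mulr1 mulrCA divff ?lt0r_neq0 // mulr1; lra.
Qed.

Lemma kl_scale p q q' (c : R) : (forall y, 0 <= p y) -> \sum_y p y = 1 ->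
  0 < c -> (forall y, q y <= c * q' y) -> (forall y, 0 < q' y) ->
  (forall y, 0 < p y -> 0 < q y) -> kl p q' <= kl p q + ln c.
Proof.
move=> p0 p1 c0 le q'0 ac.
rewrite -[ln c]mul1r -p1 mulr_suml -big_split /=; apply: ler_sum => y _.
have := p0 y; rewrite le_eqVlt => /orP [/eqP <-|py]; first by rewrite !mul0r addr0.
have qy := ac _ py.
rewrite -mulrDr ler_pM2l // !ln_div ?posrE //.
have : ln (q y) <= ln (c * q' y) by rewrite ler_ln ?posrE ?mulr_gt0.
by rewrite lnM ?posrE //; lra.
Qed.

(** Positive weights make [freq L] charge every letter, whatever [L] is: missing
    entries count as weight 1. *)
Definition weight (L : seq nat) (j : J) : nat := (nth 0 L (enum_rank j)).+1.

Definition freq (L : seq nat) (j : J) : R :=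
  (weight L j)%:R / (\sum_i weight L i)%:R.

Lemma total_weight_gt0 (L : seq nat) (j : J) : (0 < \sum_i weight L i)%N.
Proof. by rewrite (bigD1 j) //= addSn. Qed.

Lemma freq_gt0 L j : 0 < freq L j.
Proof. by rewrite divr_gt0 ?ltr0n ?(total_weight_gt0 L j). Qed.

Lemma freq_distr L (j0 : J) : is_distr (freq L).
Proof.
split=> [j|]; first exact/ltW/freq_gt0.
by rewrite -mulr_suml -natr_sum divff // pnatr_eq0 -lt0n (total_weight_gt0 L j0).
Qed.

(** Rounding the multiples [M * u j] up loses at most 1 for each index, hence
    relatively little when [M] is large. *)
Lemma freq_approx (u : J -> R) (e : R) : (forall j, 0 <= u j) -> 0 < e ->
  exists L, forall j, u j <= (\sum_i u i + e) * freq L j.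
Proof.
move=> u0 e0; pose M : R := (Num.truncn (#|J|%:R / e)).+1%:R.
have M0 : 0 < M by rewrite ltr0n.
have JM : #|J|%:R < M * e by rewrite -ltr_pdivrMr // truncnS_gt.
exists [seq Num.truncn (M * u j) | j <- enum J] => j.
set L := map _ _.
have wE i : weight L i = (Num.truncn (M * u i)).+1.
  by rewrite /weight (nth_map i) ?nth_enum_rank // -cardE ltn_ord.
have w1 i : M * u i <= (weight L i)%:R by rewrite wE ltW // truncnS_gt.
have w2 i : (weight L i)%:R <= M * u i + 1.
  by rewrite wE -natr1 lerD2r truncn_le mulr_ge0 // ltW.
have sw : (\sum_i weight L i)%:R <= M * (\sum_i u i + e).
  rewrite natr_sum; apply: (@le_trans _ _ (\sum_i (M * u i + 1))).
    exact: ler_sum.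
  rewrite big_split /= -mulr_sumr sumr_const mulrDr lerD2l.
  by rewrite -mulr_natr mul1r ltW.
have s0 : 0 < (\sum_i weight L i)%:R :> R by rewrite ltr0n (total_weight_gt0 L j).
rewrite /freq mulrA ler_pdivlMr // -(ler_pM2l M0) mulrA [leRHS]mulrA.
rewrite [leRHS]mulrC; apply: ler_pM; rewrite ?w1 ?sw ?mulr_ge0 ?u0 //; exact: ltW.
Qed.

End Divergence.

Section Information.
Variables (R : realType) (X Y : finType) (W : X -> Y -> R).
Hypothesis dW : forall x, is_distr (W x).
Implicit Types P : X -> R.

Definition output P (y : Y) : R := \sum_x P x * W x y.

(** Mutual information in natural units. *)
Definition info P : R := \sum_x P x * kl (W x) (output P).

Let W0 x y : 0 <= W x y. Proof. by case: (dW x). Qed.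

Let W1 x : \sum_y W x y = 1. Proof. by case: (dW x). Qed.

Lemma ln2_gt0 : 0 < ln 2 :> R.
Proof. by rewrite ln_gt0 // ltr1n. Qed.

Lemma mutual_infoE P : mutual_info P W * ln 2 = info P.
Proof.
rewrite /mutual_info /info mulr_suml; apply: eq_bigr => x _.
rewrite mulr_suml mulr_sumr; apply: eq_bigr => y _.
by rewrite /log2 mulrA divfK ?mulrA // lt0r_neq0 // ln2_gt0.
Qed.

Lemma output_ge0 P y : (forall x, 0 <= P x) -> 0 <= output P y.
Proof. by move=> P0; apply: sumr_ge0 => x _; rewrite mulr_ge0. Qed.

Lemma sum_output P : \sum_y output P y = \sum_x P x.
Proof.
rewrite exchange_big /=; apply: eq_bigr => x _.
by rewrite -mulr_sumr W1 mulr1.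
Qed.

Lemma output_eq0 P x y : (forall x, 0 <= P x) -> output P y = 0 ->
  P x * W x y = 0.
Proof.
move=> P0 /eqP; rewrite psumr_eq0 => [/allP H|i _]; last by rewrite mulr_ge0.
by apply/eqP; apply: H; rewrite mem_index_enum.
Qed.

(** The compensation identity: the average divergence of the rows from [Q] exceeds
    the mutual information by the divergence of the output from [Q]. *)
Lemma info_split P (Q : Y -> R) : (forall x, 0 <= P x) ->
  (forall y, 0 <= Q y) -> (forall y, Q y = 0 -> output P y = 0) ->
  \sum_x P x * kl (W x) Q = info P + kl (output P) Q.
Proof.
move=> P0 Q0 ac; rewrite {2}/kl.
under [X in _ = _ + X]eq_bigr do rewrite {1}/output mulr_suml.
rewrite exchange_big -big_split /=; apply: eq_bigr => x _.
rewrite !mulr_sumr -big_split /=; apply: eq_bigr => y _.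
have [E|nE] := eqVneq (P x * W x y) 0; first by rewrite !mulrA E !mul0r addr0.
have w0 : 0 < W x y by rewrite lt0r W0 andbT; apply: contraNneq nE => ->; rewrite mulr0.
have o0 : 0 < output P y.
  rewrite lt0r output_ge0 // andbT; apply: contraNneq nE => /output_eq0 E.
  by rewrite E.
have q0 : 0 < Q y.
  rewrite lt0r Q0 andbT; apply/eqP => /ac E; by rewrite E ltxx in o0.
by rewrite !mulrA -mulrDr !ln_div ?posrE //; congr (_ * _); ring.
Qed.

Lemma info_le P (Q : Y -> R) : is_distr P -> is_distr Q ->
  (forall y, Q y = 0 -> output P y = 0) ->
  info P <= \sum_x P x * kl (W x) Q.
Proof.
move=> [P0 P1] [Q0 Q1] ac; rewrite info_split // lerDl kl_ge0 //.
- by move=> y; exact: output_ge0.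
by rewrite sum_output P1 Q1.
Qed.

Lemma output_distr P : is_distr P -> is_distr (output P).
Proof.
by move=> [P0 P1]; split=> [y|]; [exact: output_ge0 | rewrite sum_output].
Qed.

(** The rows of the channel have nonnegative divergence from the output of [P'], so
    the average of these divergences can only grow with the weights. This takes
    the place of a continuity argument when [P] is replaced by a rational [P']. *)
Lemma info_scale P P' (c : R) : is_distr P -> is_distr P' -> 0 <= c ->
  (forall x, P x <= c * P' x) -> info P <= c * info P'.
Proof.
move=> dP dP' c0 le; have [P0 P1] := dP; have [P'0 P'1] := dP'.
have P00 x : P' x = 0 -> P x = 0.
  by move=> E; apply/eqP; rewrite eq_le P0 andbT (le_trans (le x)) // E mulr0.
apply: le_trans (info_le dP (output_distr dP') _) _ => [y /output_eq0 E|].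
  apply: big1 => x _; move/eqP: (E x P'0); rewrite mulf_eq0 => /orP [] /eqP.
    by move/P00 => ->; rewrite mul0r.
  by move=> ->; rewrite mulr0.
rewrite /info mulr_sumr; apply: ler_sum => x _; rewrite mulrA.
have [E|nE] := eqVneq (P' x) 0; first by rewrite E P00 // mulr0 !mul0r.
apply: ler_wpM2r (le x); apply: kl_ge0 => // [y|y /(output_eq0 x) E|].
- exact: output_ge0.
- by move/eqP: (E P'0); rewrite mulf_eq0 (negPf nE) => /eqP.
by rewrite sum_output P'1 W1.
Qed.

Lemma point_distr (x0 : X) : is_distr (fun x => (x == x0)%:R : R).
Proof.
split=> [x|]; first by rewrite ler0n.
by rewrite (bigD1 x0) //= eqxx big1 ?addr0 // => x /negPf ->.
Qed.

Section Nonempty.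
Variable x0 : X.

Let y0 : Y.
Proof.
case: (pickP (mem Y)) => [y _ | H]; first exact: y.
by have := W1 x0; rewrite big_pred0 // => /esym /eqP; rewrite oner_eq0.
Qed.

Let C := capacity W * ln 2.

Lemma capacity_has_sup :
  has_sup [set mutual_info P W | P in [set P : X -> R | is_distr P]]%classic.
Proof.
split; first by exists (mutual_info (fun x => (x == x0)%:R) W);
  eexists; first exact: point_distr.
exists ((\sum_x `|kl (W x) (freq R [::])|) / ln 2) => _ [P dP <-].
rewrite ler_pdivlMr ?ln2_gt0 // mutual_infoE.
apply: le_trans (info_le dP (freq_distr R [::] y0) _) _.
  by move=> y E; have := freq_gt0 R [::] y; rewrite E ltxx.
apply: ler_sum => x _; have [P0 P1] := dP.
have Px1 : P x <= 1.
  by rewrite -P1 (bigD1 x) //= lerDl sumr_ge0.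
apply: le_trans (ler_norm _) _; rewrite normrM ger0_norm //.
by rewrite -[leRHS]mul1r ler_wpM2r.
Qed.

Lemma info_le_capacity P : is_distr P -> info P <= C.
Proof.
move=> dP; rewrite -mutual_infoE ler_pM2r ?ln2_gt0 //.
by apply: ub_le_sup; [case: capacity_has_sup | exists P].
Qed.

Lemma capacity_approx (r : R) : r < C -> exists2 P, is_distr P & r < info P.
Proof.
move=> rC; have e0 : 0 < (C - r) / ln 2 by rewrite divr_gt0 ?ln2_gt0 ?subr_gt0.
have [_ [P dP <-] H] := sup_adherent e0 capacity_has_sup.
exists P => //; rewrite -mutual_infoE -ltr_pdivrMr ?ln2_gt0 //.
apply: le_lt_trans H; rewrite -/(capacity W) mulrBl /C mulfK ?lt0r_neq0 ?ln2_gt0 //.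
by rewrite opprB addrC subrK.
Qed.

Lemma capacity_gt (r : R) : r < C <-> exists L, r < info (freq R L).
Proof.
split=> [/capacity_approx [P dP lt]|[L lt]]; last first.
  exact: lt_le_trans lt (info_le_capacity (freq_distr R L x0)).
have [P0 P1] := dP; pose e := (info P - r) / (2 * (`|r| + 1)).
have d0 : 0 < 2 * (`|r| + 1) by have := normr_ge0 r; lra.
have e0 : 0 < e by rewrite divr_gt0 // subr_gt0.
have [L HL] := freq_approx P0 e0; rewrite P1 in HL.
exists L; have := info_scale dP (freq_distr R L x0) _ HL.
have c0 : 0 < 1 + e by lra.
move=> /(_ (ltW c0)) H; rewrite -(ltr_pM2l c0); apply: lt_le_trans H.
have : e * (2 * (`|r| + 1)) = info P - r by rewrite divfK // lt0r_neq0.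
have := ler_norm r; rewrite mulrDl mul1r; nra.
Qed.

(** For a nearly optimal [P], moving the mass [t] to the letter [x] cannot gain
    much, which bounds the divergence of [W x] from the perturbed output. *)
Lemma kl_perturbed P (t e : R) x : is_distr P -> 0 < t < 1 -> 0 <= e ->
  C - t * e < info P ->
  kl (W x) (fun y => (1 - t) * output P y + t * W x y) <= C + e.
Proof.
move=> dP /andP [t0 t1] e0 near; have [P0 P1] := dP.
pose Pt z := (1 - t) * P z + t * (z == x)%:R.
have [D0 D1] := point_distr x.
have dPt : is_distr Pt.
  split=> [z|]; first by rewrite addr_ge0 ?mulr_ge0 ?subr_ge0 // ltW.
  by rewrite big_split /= -!mulr_sumr P1 D1; ring.
have oE : (fun y => (1 - t) * output P y + t * W x y) = output Pt.
  apply: funext => y; rewrite /output /Pt.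
  under [RHS]eq_bigr do rewrite mulrDl -!mulrA.
  rewrite big_split /= -!mulr_sumr; congr (_ + _ * _).
  by rewrite (bigD1 x) //= eqxx mul1r big1 ?addr0 // => z /negPf ->; rewrite mul0r.
rewrite oE; have := info_le_capacity dPt.
have -> : info Pt = (1 - t) * (\sum_z P z * kl (W z) (output Pt))
    + t * kl (W x) (output Pt).
  rewrite {1}/info; under eq_bigr do rewrite mulrDl -!mulrA.
  rewrite big_split /= -!mulr_sumr; congr (_ + _ * _).
  by rewrite (bigD1 x) //= eqxx mul1r big1 ?addr0 // => z /negPf ->; rewrite mul0r.
have := info_le dP (output_distr dPt) _.
have ac y : output Pt y = 0 -> output P y = 0.
  rewrite -oE => E; apply/eqP; rewrite eq_le output_ge0 // andbT.
  have /(mulr_ge0 (ltW t0)) := W0 x y; have := output_ge0 y P0; nra.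
move=> /(_ ac); set S := \sum_z _; set k := kl _ _ => H1 H2.
suff : t * k <= t * (C + e) by rewrite ler_pM2l.
have : (1 - t) * info P <= (1 - t) * S by rewrite ler_pM2l // subr_gt0.
have : (1 - t) * (C - t * e) <= (1 - t) * info P.
  by rewrite ler_pM2l ?subr_gt0 // ltW.
have : 0 <= t * (t * e) by rewrite !mulr_ge0 // ltW.
by lra.
Qed.

(** One output distribution is within [r] of all rows of the channel: the
    perturbed outputs of the previous lemma are dominated by a common one. *)
Lemma capacity_lt (r : R) : C < r <-> exists L, forall x, kl (W x) (freq R L) < r.
Proof.
split=> [Cr|[L HL]]; last first.
  have [x _ max] : exists2 x, true & forall z,
      kl (W z) (freq R L) <= kl (W x) (freq R L).
    have := @arg_maxP _ R X x0 xpredT (fun z => kl (W z) (freq R L)) isT.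
    by case=> x _ H; exists x => // z; exact: H.
  apply: le_lt_trans (HL x); rewrite leNgt; apply/negP.
  move=> /capacity_approx [P dP]; apply/negP; rewrite -leNgt.
  apply: le_trans (info_le dP (freq_distr R L y0) _) _.
    by move=> y E; have := freq_gt0 R L y; rewrite E ltxx.
  have [P0 P1] := dP; rewrite -[leRHS]mul1r -P1 mulr_suml.
  by apply: ler_sum => z _; rewrite ler_wpM2l.
pose e := (r - C) / 4%:R; have e0 : 0 < e by rewrite divr_gt0 // subr_gt0.
pose n : R := #|X|%:R; have n0 : 0 <= n by rewrite ler0n.
pose t := e / (e + n + 1); have d0 : 0 < e + n + 1 by lra.
have t01 : 0 < t < 1 by rewrite divr_gt0 //= ltr_pdivrMr // mul1r; lra.
have tn : t * n <= e.
  by rewrite mulrAC ler_pdivrMr // ler_pM2l //; lra.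
have [t0 t1] := andP t01.
have [P dP near] : exists2 P, is_distr P & C - t * e < info P.
  by apply: capacity_approx; rewrite ltrBlDr ltrDl mulr_gt0.
have [P0 P1] := dP.
pose Q y := (1 - t) * output P y + t * \sum_x W x y.
have Q0 y : 0 <= Q y.
  apply: addr_ge0; apply: mulr_ge0.
  - by rewrite subr_ge0 ltW.
  - exact: output_ge0.
  - exact: ltW.
  by apply: sumr_ge0.
have sQ : \sum_y Q y <= 1 + e.
  rewrite big_split /= -!mulr_sumr sum_output P1 exchange_big /=.
  under eq_bigr do rewrite W1.
  by rewrite sumr_const -[_ *+ _]/n; lra.
have [L HL] := freq_approx Q0 e0; exists L => x.
pose Qx y := (1 - t) * output P y + t * W x y.
have c0 : 0 < 1 + (e + e) by lra.
have le y : Qx y <= (1 + (e + e)) * freq R L y.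
  apply: (@le_trans _ _ (Q y)).
    rewrite lerD2l ler_pM2l // (bigD1 x) //= lerDl sumr_ge0 //.
  apply: le_trans (HL y) _; rewrite ler_wpM2r ?addrA ?lerD2r //.
  exact/ltW/freq_gt0.
have ac y : 0 < W x y -> 0 < Qx y.
  move=> w0; apply: ltr_wpDl; last exact: mulr_gt0.
  by apply: mulr_ge0; [rewrite subr_ge0 ltW | exact: output_ge0].
have := kl_scale (W0 x) (W1 x) c0 le (freq_gt0 R L) ac.
move=> /le_lt_trans; apply; have := kl_perturbed x dP t01 (ltW e0) near.
have : ln (1 + (e + e)) <= e + e by apply: le_ln1Dx; lra.
rewrite -/Qx; have : e * 4%:R = r - C by rewrite divfK // pnatr_eq0.
by lra.
Qed.

End Nonempty.
End Information.

Lemma comp_sum {T I : Type} {nT : named T} (f : I -> T -> nat) (s : seq I) :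
  (forall i, comp (f i)) -> comp (fun t => \sum_(i <- s) f i t)%N.
Proof.
move=> cf; elim: s => [|i s IH].
  by apply: comp_ext (comp_const 0%N) => t; rewrite big_nil.
by apply: comp_ext (comp_add (cf i) IH) => t; rewrite big_cons.
Qed.

Lemma creal_freq {R : realType} {T : Type} {nT : named T} (J : finType) (L : T -> seq nat) (j : J) :
  comp L -> creal (fun t => freq R (L t) j).
Proof.
move=> cL.
have cw i : comp (fun t => weight (L t) (i : J)).
  by apply: comp_S; exact: comp_nth.
pose q t : frac := (weight (L t) j, 0, (\sum_(i : J) weight (L t) i).-1)%N.
apply: (creal_ext (x := fun t => qv (q t) : R)) => [t|].
  by rewrite /qv /= subr0 prednK // (total_weight_gt0 (L t) j).
apply: creal_qv; apply: comp_pair; first by qcomp.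
by apply: comp_pred; exact: comp_sum.
Qed.

Section CapacityCuts.
Context {R : realType} {X Y : finType} {T : Type} {nT : named T}.

Variable W : T -> X -> Y -> R.
Hypothesis dW : forall t x, is_distr (W t x).
Hypothesis cW : forall x y, creal (fun t => W t x y).

(** Differences of entropies avoid the quotients in the mutual information, whose
    denominators may vanish. *)
Lemma info_entropy t (P : X -> R) : (forall x, 0 <= P x) ->
  info (W t) P = \sum_x \sum_y P x * (W t x y * ln (W t x y))
    - \sum_y output (W t) P y * ln (output (W t) P y).
Proof.
move=> P0; have W0 x y : 0 <= W t x y by case: (dW t x).
under [X in _ - X]eq_bigr do rewrite {1}/output mulr_suml.
rewrite [X in _ - X]exchange_big -sumrB /=; apply: eq_bigr => x _.
rewrite mulr_sumr -sumrB; apply: eq_bigr => y _.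
have [E|nE] := eqVneq (P x * W t x y) 0; first by rewrite !mulrA E !mul0r subrr.
have w0 : 0 < W t x y.
  by rewrite lt0r W0 andbT; apply: contraNneq nE => ->; rewrite mulr0.
have o0 : 0 < output (W t) P y.
  rewrite lt0r output_ge0 // andbT; apply: contraNneq nE.
  by move/(output_eq0 (dW t) x P0) => ->.
by rewrite ln_div ?posrE // mulrA -mulrA mulrBr mulrA mulrBr !mulrA.
Qed.

Lemma creal_capacity_empty : (X -> False) ->
  creal (fun t => capacity (W t) * ln 2).
Proof.
move=> noX; apply: (creal_ext (x := fun _ => 0%:R : R)) => [t|];
  last exact: creal_const_nat.
rewrite /capacity (_ : [set _ | _ in _]%classic = set0) ?sup0 ?mul0r //.
rewrite -subset0 => z [P [_ P1] _]; move: P1.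
rewrite big_pred0 => [/esym /eqP|x]; first by rewrite oner_eq0.
by have := noX x.
Qed.

(** A lower bound is witnessed by a rational input distribution, an upper bound by
    a rational output distribution. *)
Lemma creal_capacity : creal (fun t => capacity (W t) * ln 2).
Proof.
case: (pickP (mem X)) => [x0 _|noX]; last first.
  by apply: creal_capacity_empty => x; have := noX x.
have W0 t x y : 0 <= W t x y by case: (dW t x).
have cWf (U : Type) (nU : named U) (f : U -> T) x y : comp f ->
    creal (fun u => W (f u) x y).
  by move=> cf; exact: (creal_comp (cW x y) cf).
have c11 : comp (fun p : T * frac * seq nat => p.1.1) by qcomp.
have cL : comp (fun p : T * frac * seq nat => p.2) by qcomp.
split.
  apply: (re_iff (Q := fun p : T * frac => exists L,
    qv p.2 < info (W p.1) (freq R L))) => [p|].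
    exact: (capacity_gt (dW p.1) x0).
  apply: re_ex; apply: re_gtq; last by qcomp.
  apply: (creal_ext (x := fun p : T * frac * seq nat =>
    \sum_x \sum_y freq R p.2 x * (W p.1.1 x y * ln (W p.1.1 x y))
     - \sum_y output (W p.1.1) (freq R p.2) y *
              ln (output (W p.1.1) (freq R p.2) y))) => [p|].
    by rewrite info_entropy // => x; exact/ltW/freq_gt0.
  apply: creal_sub.
    do 2![apply: creal_sum => ?]; apply: creal_mul; first exact: creal_freq.
    by apply: creal_xlnx => //; exact: cWf.
  apply: creal_sum => y; apply: creal_xlnx => [p|].
    by apply: output_ge0 => // x; exact/ltW/freq_gt0.
  apply: creal_sum => x; apply: creal_mul; first exact: creal_freq.
  exact: cWf.
apply: (re_iff (Q := fun p : T * frac => exists L, forall x : X,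
  kl (W p.1 x) (freq R L) < qv p.2)) => [p|].
  exact: (capacity_lt (dW p.1) x0).
apply: re_ex; apply: re_forall => x; apply: re_ltq; last by qcomp.
apply: (creal_ext (x := fun p : T * frac * seq nat =>
  \sum_y (W p.1.1 x y * ln (W p.1.1 x y) - W p.1.1 x y * ln (freq R p.2 y)))).
  move=> p; apply: eq_bigr => y _; have := W0 p.1.1 x y.
  rewrite le_eqVlt => /orP [/eqP <-|w0]; first by rewrite !mul0r subrr.
  by rewrite ln_div ?posrE // ?freq_gt0 // mulrBr.
apply: creal_sum => y; apply: creal_sub.
  by apply: creal_xlnx => //; exact: cWf.
apply: creal_mul; first exact: cWf.
apply: creal_ln => [p|]; [exact: freq_gt0 | exact: creal_freq].
Qed.

End CapacityCuts.

(** * Mahler measure and Graeffe iteration *)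

Section Graeffe.
Variable F : comNzRingType.
Implicit Type p : {poly F}.

(** The product of [p] and [p \Po - 'X] is even, and as a polynomial in ['X^2] it
    has the squares of the roots of [p] as its roots. *)
Definition graeffe p : {poly F} := even_poly (p * (p \Po - 'X)).

(** [graeffe] on the level of coefficient sequences. *)
Definition graeffe_coef (u : nat -> F) (i : nat) : F :=
  \sum_(j < i.*2.+1) u j * ((-1) ^+ (i.*2 - j) * u (i.*2 - j)%N).

Lemma coef_compNX p i : (p \Po - 'X)`_i = (-1) ^+ i * p`_i.
Proof.
rewrite comp_polyE coef_sum.
have E j : (-1 : {poly F}) ^+ j = ((-1) ^+ j)%:P by rewrite rmorphXn rmorphN1.
under eq_bigr => j _ do rewrite exprNn E coefZ coefCM coefXn.
have [ip|ip] := ltnP i (size p).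
  rewrite (bigD1 (Ordinal ip)) //= eqxx mulr1 big1 ?addr0 1?mulrC //.
  by move=> j; rewrite -val_eqE /= eq_sym => /negPf ->; rewrite !mulr0.
rewrite (nth_default _ ip) mulr0 big1 // => j _.
by rewrite gtn_eqF ?mulr0 // (leq_trans (ltn_ord j)).
Qed.

Lemma coef_graeffe p i : (graeffe p)`_i = graeffe_coef (fun j => p`_j) i.
Proof.
rewrite coef_even_poly coefM; apply: eq_bigr => j _.
by rewrite coef_compNX.
Qed.

Lemma even_poly_comp p : even_poly (p \Po 'X^2) = p.
Proof.
apply/polyP => i; rewrite coef_even_poly coef_comp_poly_Xn // -muln2.
by rewrite dvdn_mull // mulnK.
Qed.

Lemma graeffe_factor (c : F) (s : seq F) :
  graeffe (c *: \prod_(z <- s) ('X - z%:P)) =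
  (c ^+ 2 * (-1) ^+ size s) *: \prod_(z <- s) ('X - (z ^+ 2)%:P).
Proof.
rewrite /graeffe comp_polyZ -scalerAl -scalerAr scalerA -expr2 linearZ /=.
rewrite -scalerA; congr (_ *: _); rewrite -[RHS]even_poly_comp; congr even_poly.
rewrite comp_polyZ; elim: s => [|z s IH].
  by rewrite !big_nil !comp_polyC mulr1 expr0 scale1r.
rewrite !big_cons !comp_polyM !comp_polyB !comp_polyX !comp_polyC mulrACA IH.
move: (_ \Po 'X^2) => Q.
rewrite /= exprS -scalerA scaleN1r -scalerAr -scalerN; congr (_ *: _).
by rewrite [(z ^+ 2)%:P]rmorphXn /=; ring.
Qed.
End Graeffe.

Section Mahler.
Variable R : realType.
Local Notation C := R[i]%C.
Implicit Types (z : C) (P Q : {poly C}).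

Definition sqn z : R := complex.Re z ^+ 2 + complex.Im z ^+ 2.

Lemma modulus_sqr z : modulus z ^+ 2 = sqn z.
Proof.
case: z => a b; rewrite /modulus /= sqr_sqrtr //.
by rewrite addr_ge0 ?sqr_ge0.
Qed.

Lemma modulus_ge0 z : 0 <= modulus z.
Proof. by case: z => a b; exact: sqrtr_ge0. Qed.

Lemma modulusM z t : modulus (z * t) = modulus z * modulus t.
Proof. exact: ComplexField.Normc.normcM. Qed.

Lemma modulus1 : modulus (1 : C) = 1.
Proof. exact: ComplexField.Normc.normc1. Qed.

Lemma modulusX z n : modulus (z ^+ n) = modulus z ^+ n.
Proof.
elim: n => [|n IH]; first by rewrite !expr0 modulus1.
by rewrite !exprS modulusM IH.
Qed.

Lemma modulusN z : modulus (- z) = modulus z.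
Proof. by case: z => a b; rewrite /modulus /= !sqrrN. Qed.

Lemma sqn_ge0 z : 0 <= sqn z.
Proof. by rewrite addr_ge0 ?sqr_ge0. Qed.

Lemma sqnM z t : sqn (z * t) = sqn z * sqn t.
Proof. by rewrite -!modulus_sqr modulusM exprMn. Qed.

Definition energy P : R := \sum_(i < size P) sqn P`_i.

Lemma sqn0 : sqn 0 = 0.
Proof. by rewrite /sqn /= expr0n addr0. Qed.

Lemma energyE P N : (size P <= N)%N -> energy P = \sum_(i < N) sqn P`_i.
Proof.
move=> le; rewrite /energy (big_ord_widen N (fun i => sqn P`_i) le).
rewrite big_mkcond; apply: eq_bigr => i _; case: ltnP => // /(nth_default 0) ->.
by rewrite sqn0.
Qed.

Lemma sqn_swap (a b z : C) :
  sqn (a - z * b) + (sqn b + sqn z * sqn a)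
  = sqn (b - conjc z * a) + (sqn a + sqn z * sqn b).
Proof. by case: a b z => [a a'] [b b'] [z z']; rewrite /sqn /=; ring. Qed.

Lemma sqn_sub_le (a b : C) : sqn (a - b) <= 2 * (sqn a + sqn b).
Proof.
case: a b => [a a'] [b b']; rewrite /sqn /=.
by have := sqr_ge0 (a + b); have := sqr_ge0 (a' + b'); lra.
Qed.

Lemma coef_mulXsubC Q z i :
  (('X - z%:P) * Q)`_i = (if i is j.+1 then Q`_j else 0) - z * Q`_i.
Proof. by rewrite mulrBl coefB coefXM coefCM; case: i. Qed.

Lemma coef_mul1subX Q z i :
  ((1 - z *: 'X) * Q)`_i = Q`_i - z * (if i is j.+1 then Q`_j else 0).
Proof. by rewrite mulrBl mul1r coefB -scalerAl coefZ coefXM; case: i. Qed.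

Lemma energy_shift Q N : (size Q <= N)%N ->
  energy Q = \sum_(i < N.+1) sqn (if val i is j.+1 then Q`_j else 0).
Proof.
by move=> le; rewrite (energyE le) big_ord_recl /= sqn0 add0r.
Qed.

Lemma size_mul_linear (A Q : {poly C}) :
  (size A <= 2)%N -> (size (A * Q)%R <= (size Q).+1)%N.
Proof. by move=> le; apply: leq_trans (size_polyMleq _ _) _; lia. Qed.

Lemma size_1subX z : (size (1 - z *: 'X)%R <= 2)%N.
Proof.
apply: leq_trans (size_polyD _ _) _; rewrite geq_max size_poly1 size_polyN /=.
by apply: leq_trans (size_scale_leq _ _) _; rewrite size_polyX.
Qed.

(** Once [(1 + sqn z) * energy Q] is split in the two ways in which it arises from
    [Q] and its shift, the identity is [sqn_swap], coefficient by coefficient. *)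
Lemma energy_reflect Q z :
  energy (('X - z%:P) * Q) = energy ((1 - conjc z *: 'X) * Q).
Proof.
have s1 : (size (('X - z%:P) * Q)%R <= (size Q).+1)%N.
  by apply: size_mul_linear; rewrite size_XsubC.
have s2 := size_mul_linear Q (size_1subX (conjc z)).
pose pr (i : 'I_(size Q).+1) : C := if val i is j.+1 then Q`_j else 0.
have e1 : energy Q = \sum_i sqn (pr i) by exact: energy_shift.
have e2 : energy Q = \sum_(i < (size Q).+1) sqn Q`_i by exact: energyE.
rewrite (energyE s1) (energyE s2); apply: (addIr (energy Q + sqn z * energy Q)).
rewrite [X in _ + (X + _ * _) = _]e2 [X in _ + (_ + _ * X) = _]e1.
rewrite [X in _ = _ + (X + _)]e1 [X in _ = _ + (_ + _ * X)]e2.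
rewrite !mulr_sumr -!big_split /=.
by apply: eq_bigr => i _; rewrite coef_mulXsubC coef_mul1subX; exact: sqn_swap.
Qed.

Lemma energy_mul_le Q z :
  energy (('X - z%:P) * Q) <= 4%:R * Num.max 1 (modulus z) ^+ 2 * energy Q.
Proof.
have s1 : (size (('X - z%:P) * Q)%R <= (size Q).+1)%N.
  by apply: size_mul_linear; rewrite size_XsubC.
pose pr (i : 'I_(size Q).+1) : C := if val i is j.+1 then Q`_j else 0.
have e1 : energy Q = \sum_i sqn (pr i) by exact: energy_shift.
have e2 : energy Q = \sum_(i < (size Q).+1) sqn Q`_i by exact: energyE.
have E0 : 0 <= energy Q by apply: sumr_ge0 => i _; exact: sqn_ge0.
apply: (@le_trans _ _ (2 * (energy Q + sqn z * energy Q))).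
  rewrite (energyE s1) {1}e1 e2 mulr_sumr -big_split mulr_sumr /=.
  apply: ler_sum => i _; rewrite coef_mulXsubC -sqnM; exact: sqn_sub_le.
rewrite -modulus_sqr; set m := Num.max 1 _.
have m1 : 1 <= m by rewrite le_max lexx.
have mz : modulus z <= m by rewrite le_max lexx orbT.
have := modulus_ge0 z; set r := modulus z in mz *.
have h1 : 1 <= m ^+ 2 by rewrite expr2; nra.
have h2 : 0 <= r -> r ^+ 2 <= m ^+ 2 by move=> r0; rewrite !expr2; nra.
move=> /h2 {}h2.
have : (1 + r ^+ 2) * energy Q <= (m ^+ 2 + m ^+ 2) * energy Q.
  by rewrite ler_wpM2r // lerD.
by lra.
Qed.

Definition mahler (s : seq C) : R := \prod_(z <- s) Num.max 1 (modulus z).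

Lemma mahler_ge1 s : 1 <= mahler s.
Proof.
apply: (big_ind (fun x : R => 1 <= x)) => // [x y x1 y1|z _].
  by rewrite -[leLHS]mul1r ler_pM.
by rewrite le_max lexx.
Qed.

Lemma energyZ (c : C) Q : modulus c = 1 -> energy (c *: Q) = energy Q.
Proof.
move=> c1; rewrite (@energyE (c *: Q) (size Q)) ?size_scale_leq //.
apply: eq_bigr => i _.
by rewrite coefZ sqnM -modulus_sqr c1 expr1n mul1r.
Qed.

Lemma energy_le_mahler s :
  energy (\prod_(z <- s) ('X - z%:P)) <= 4%:R ^+ size s * mahler s ^+ 2.
Proof.
elim: s => [|z s IH].
  rewrite /mahler !big_nil /energy size_poly1 big_ord1 coef1 /=.
  by rewrite -modulus_sqr modulus1 expr0 !expr1n mulr1.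
rewrite /mahler !big_cons -/(mahler s); apply: le_trans (energy_mul_le _ _) _.
rewrite exprMn /= (exprS 4%:R) [leRHS]mulrACA ler_wpM2l //.
by rewrite mulr_ge0 // sqr_ge0.
Qed.

(** After reflecting the roots outside the unit disc, the Mahler measure is the
    modulus of the leading coefficient. *)
Lemma mahler_le_energy s :
  mahler s ^+ 2 <= energy (\prod_(z <- s) ('X - z%:P)).
Proof.
pose f z : {poly C} := if 1 <= modulus z then 1 - conjc z *: 'X else 'X - z%:P.
have fE z Q : energy (('X - z%:P) * Q) = energy (f z * Q).
  by rewrite /f; case: ifP => // _; exact: energy_reflect.
have E Q : energy (\prod_(z <- s) ('X - z%:P) * Q) = energy (\prod_(z <- s) f z * Q).
  elim: s Q => [|z s IH] Q; first by rewrite !big_nil.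
  by rewrite !big_cons -mulrA fE (mulrCA (f z)) IH -mulrA (mulrCA (f z)).
have := E 1; rewrite !mulr1 => ->.
have lf z : modulus (lead_coef (f z)) = Num.max 1 (modulus z).
  rewrite /f; case: (leP 1 (modulus z)) => z1; last first.
    by rewrite lead_coefXsubC modulus1.
  have zn0 : - conjc z != 0.
    rewrite oppr_eq0 conjc_eq0; apply: contraTneq z1 => ->.
    by rewrite /modulus ComplexField.Normc.normc0 ler10.
  rewrite -polyC1 -scaleNr addrC lead_coefDl; last first.
    rewrite size_scale // size_polyX size_polyC; by case: (_ != _).
  rewrite lead_coefZ lead_coefX mulr1 modulusN.
  by case: (z) => a b; rewrite /modulus /= sqrrN.
have -> : mahler s = modulus (lead_coef (\prod_(z <- s) f z)).
  rewrite lead_coef_prod /mahler; elim: (s) => [|z s' IH].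
    by rewrite !big_nil modulus1.
  by rewrite !big_cons modulusM lf IH.
rewrite modulus_sqr lead_coefE /energy; set P := \prod_(z <- s) f z.
case sP: (size P) => [|k].
  rewrite big_ord0; move/eqP: sP; rewrite size_poly_eq0 => /eqP ->.
  by rewrite coef0 sqn0.
by rewrite big_ord_recr /= lerDr sumr_ge0 // => i _; exact: sqn_ge0.
Qed.

Lemma mahler_sqr s : mahler [seq z ^+ 2 | z <- s] = mahler s ^+ 2.
Proof.
rewrite /mahler big_map -prodrXl; apply: eq_bigr => z _.
rewrite modulusX; have := modulus_ge0 z; set r := modulus z => r0.
case: (leP 1 r) => r1; first by rewrite max_r // expr2; nra.
by rewrite expr1n max_l // expr2; nra.
Qed.

(** Along the iteration the energy is squeezed between powers of the Mahler
    measure, so that its normalised logarithm converges. *)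
Lemma energy_graeffe_bounds P (c : C) (s : seq C) k :
  modulus c = 1 -> P = c *: \prod_(z <- s) ('X - z%:P) ->
  mahler s ^+ (2 ^ k.+1) <= energy (iter k (@graeffe C) P)
    <= 4%:R ^+ size s * mahler s ^+ (2 ^ k.+1).
Proof.
elim: k P c s => [|k IH] P c s c1 ->.
  by rewrite /= energyZ // mahler_le_energy energy_le_mahler.
rewrite iterSr; have := IH (graeffe (c *: \prod_(z <- s) ('X - z%:P)))
  (c ^+ 2 * (-1) ^+ size s) [seq z ^+ 2 | z <- s].
rewrite size_map mahler_sqr -exprM -expnS; apply; last first.
  by rewrite graeffe_factor big_map.
by rewrite modulusM !modulusX modulusN modulus1 c1 !expr1n mulr1.
Qed.

End Mahler.

(** * Graeffe iteration on rational approximations *)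

Definition qsum (l : seq frac) : frac := foldr qadd (qnat 0) l.

Lemma qv_sum (R : realType) (I : Type) (f : I -> frac) (l : seq I) :
  qv (qsum [seq f i | i <- l]) = \sum_(i <- l) qv (f i) :> R.
Proof.
elim: l => [|i l IH]; first by rewrite big_nil qv_nat.
by rewrite big_cons -IH -qvD.
Qed.

Lemma comp_qsum {T I : Type} {nT : named T} (f : I -> T -> frac) (l : seq I) :
  (forall i, comp (f i)) -> comp (fun t => qsum [seq f i t | i <- l]).
Proof.
move=> cf; elim: l => [|i l IH]; first exact: comp_const.
by apply: comp_qadd.
Qed.

(** An approximation of a coefficient vector: rational entries, and a bound for
    the error of each of them. *)
Notation approx := (seq frac * frac)%type.

Definition qnth (z : seq frac) (j : nat) : frac := nth (0, 0, 0)%N z j.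

Definition qsign (n : nat) (q : frac) : frac := if odd n then qopp q else q.

Definition qgraeffe (z : seq frac) (i : nat) : frac :=
  qsum [seq qmul (qnth z j) (qsign (i.*2 - j)%N (qnth z (i.*2 - j)%N))
       | j <- iota 0 i.*2.+1].

Definition qenergy (n : nat) (z : seq frac) : frac :=
  qsum [seq qmul (qnth z j) (qnth z j) | j <- iota 0 n.+1].

(** The entries are bounded by [K = 1 + qenergy n z], so that a product of two
    coefficients is known up to [r * (2 * K + r)] when the entries are known up
    to [r]. *)
Definition qradius (n : nat) (s : approx) : frac :=
  qmul (qmul (qnat n.*2.+1) s.2)
       (qadd (qmul (qnat 2) (qadd (qnat 1) (qenergy n s.1))) s.2).

Definition qstep (n : nat) (s : approx) : approx :=
  ([seq qgraeffe s.1 i | i <- iota 0 n.+1], qradius n s).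

Lemma qnth_iota (f : nat -> frac) (N j : nat) : (j < N)%N ->
  qnth [seq f i | i <- iota 0 N] j = f j.
Proof. by move=> jN; rewrite /qnth (nth_map 0%N) ?size_iota // nth_iota. Qed.

Lemma comp_qnth {T : Type} {nT : named T} (f : T -> seq frac) j :
  comp f -> comp (fun t => qnth (f t) j).
Proof. exact: comp_nth. Qed.

Lemma comp_qenergy {T : Type} {nT : named T} n (f : T -> seq frac) :
  comp f -> comp (fun t => qenergy n (f t)).
Proof.
by move=> cf; apply: comp_qsum => j; apply: comp_qmul; exact: comp_qnth.
Qed.

Lemma comp_qradius {T : Type} {nT : named T} n (f : T -> approx) :
  comp f -> comp (fun t => qradius n (f t)).
Proof.
move=> cf; rewrite /qradius; qcomp; apply: comp_qenergy; exact: comp_fst.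
Qed.

Lemma comp_qstep n : comp (qstep n).
Proof.
apply: comp_pair; last by apply: comp_qradius; exact: comp_id.
apply: comp_map => i; apply: comp_qsum => j; apply: comp_qmul.
  by apply: comp_qnth; exact/comp_fst/comp_id.
rewrite /qsign; case: odd; first apply: comp_qopp;
  by apply: comp_qnth; exact/comp_fst/comp_id.
Qed.

Section Approximation.
Context {R : realType}.
Variable n : nat.
Implicit Types (u : nat -> R) (s : approx).

Local Notation qr q := (qv q : R).

Definition supported u : Prop := forall j, (n < j)%N -> u j = 0.

Definition near u s : Prop :=
  [/\ 0 <= qr s.2, forall j, `|u j - qr (qnth s.1 j)| <= qr s.2
    & forall j, (n < j)%N -> qnth s.1 j = (0, 0, 0)%N].

Lemma qv0 : qr (0, 0, 0)%N = 0.
Proof. by rewrite /qv /= subrr mul0r. Qed.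

Lemma qv_sign m q : qr (qsign m q) = (-1) ^+ m * qr q.
Proof.
by rewrite /qsign -signr_odd; case: odd; rewrite ?qvN ?expr1 ?mulN1r // mul1r.
Qed.

Lemma qenergyE z : qr (qenergy n z) = \sum_(j < n.+1) qr (qnth z j) ^+ 2.
Proof.
rewrite qv_sum -[iota _ _]/(index_iota 0 n.+1) big_mkord.
by apply: eq_bigr => j _; rewrite qvM expr2.
Qed.

Lemma qradiusE s : qr (qradius n s) =
  n.*2.+1%:R * (qr s.2 * (2 * (1 + \sum_(j < n.+1) qr (qnth s.1 j) ^+ 2) + qr s.2)).
Proof. by rewrite /qradius qvM qvM qvD qvM qvD !qv_nat qenergyE mulrA. Qed.

Lemma mul_error (a b x y r K : R) : 0 <= r -> `|a - x| <= r -> `|b - y| <= r ->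
  `|x| <= K -> `|y| <= K -> `|a * b - x * y| <= r * (2 * K + r).
Proof.
move=> r0 ax by_ xK yK.
have -> : a * b - x * y = (a - x) * (b - y) + ((a - x) * y + x * (b - y)) by ring.
have h1 : `|(a - x) * (b - y)| <= r * r by rewrite normrM ler_pM.
have h2 : `|(a - x) * y| <= r * K by rewrite normrM ler_pM.
have h3 : `|x * (b - y)| <= r * K by rewrite mulrC normrM ler_pM.
have := ler_normD ((a - x) * (b - y)) ((a - x) * y + x * (b - y)).
have := ler_normD ((a - x) * y) (x * (b - y)).
by lra.
Qed.

Lemma near_entry u s j : near u s ->
  `|qr (qnth s.1 j)| <= 1 + \sum_(j < n.+1) qr (qnth s.1 j) ^+ 2.
Proof.
case=> _ _ z0.
have S0 : 0 <= \sum_(j < n.+1) qr (qnth s.1 j) ^+ 2.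
  by apply: sumr_ge0 => i _; exact: sqr_ge0.
have [nj|jn] := ltnP n j; first by rewrite z0 // qv0 normr0; lra.
have : qr (qnth s.1 j) ^+ 2 <= \sum_(j < n.+1) qr (qnth s.1 j) ^+ 2.
  rewrite (bigD1 (Ordinal (jn : (j < n.+1)%N))) //= lerDl.
  by apply: sumr_ge0 => i _; exact: sqr_ge0.
by rewrite -real_normK ?num_real // expr2; nra.
Qed.

Lemma near_mul u s j l : near u s ->
  `|u j * u l - qr (qnth s.1 j) * qr (qnth s.1 l)| <=
  qr s.2 * (2 * (1 + \sum_(j < n.+1) qr (qnth s.1 j) ^+ 2) + qr s.2).
Proof.
by move=> nr; case: (nr) => r0 H _; apply: mul_error => //; exact: near_entry nr.
Qed.

Lemma near_radius_ge0 u s : near u s -> 0 <= qr (qradius n s).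
Proof.
case=> r0 _ _; rewrite qradiusE; apply: mulr_ge0 => //; apply: mulr_ge0 => //.
by rewrite addr_ge0 // mulr_ge0 // addr_ge0 // sumr_ge0 // => i _; exact: sqr_ge0.
Qed.

Lemma graeffe_supported u : supported u -> supported (graeffe_coef u).
Proof.
move=> u0 i ni; apply: big1 => j _.
have [nj|jn] := ltnP n j; first by rewrite u0 // mul0r.
rewrite [u (_ - _)%N]u0 ?mulr0 //.
by move: (nat_of_ord j) jn => m mn; rewrite -addnn; lia.
Qed.

Lemma sum_error (m : nat) (a b : nat -> R) (e : R) : (m <= n.*2.+1)%N -> 0 <= e ->
  (forall j, `|a j - b j| <= e) ->
  `|\sum_(j < m) a j - \sum_(j < m) b j| <= n.*2.+1%:R * e.
Proof.
move=> mn e0 H; rewrite -sumrB; apply: le_trans (ler_norm_sum _ _ _) _.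
apply: (@le_trans _ _ (\sum_(j < m) e)); first by apply: ler_sum => j _.
by rewrite sumr_const card_ord -[e *+ m]mulr_natl ler_wpM2r // ler_nat.
Qed.

Lemma near_step u s : supported u -> near u s ->
  near (graeffe_coef u) (qstep n s).
Proof.
move=> u0 nr; have rad0 := near_radius_ge0 nr.
have tail j : (n < j)%N -> qnth (qstep n s).1 j = (0, 0, 0)%N.
  by move=> nj; rewrite /qnth nth_default // size_map size_iota.
split=> // i; have [ni|iN] := ltnP n i.
  by rewrite tail // qv0 graeffe_supported // subrr normr0.
rewrite (_ : qnth (qstep n s).1 i = qgraeffe s.1 i); last exact: qnth_iota.
rewrite [(qstep n s).2]/(qradius n s) qv_sum -[iota _ _]/(index_iota 0 i.*2.+1) big_mkord qradiusE.
under eq_bigr => j _ do rewrite qvM qv_sign.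
apply: (@sum_error i.*2.+1 (fun j => u j * ((-1) ^+ (i.*2 - j) * u (i.*2 - j)%N))
 (fun j => qv (qnth s.1 j) * ((-1) ^+ (i.*2 - j) * qv (qnth s.1 (i.*2 - j))))).
- by rewrite ltnS leq_double.
- apply: le_trans (near_mul 0 0 nr); exact: normr_ge0.
move=> j; rewrite mulrCA [qv _ * _]mulrCA -mulrBr normrM normrX normrN1 expr1n mul1r.
exact: near_mul.
Qed.

Lemma near_energy u s : near u s ->
  `|\sum_(j < n.+1) u j ^+ 2 - qr (qenergy n s.1)| <= qr (qradius n s).
Proof.
move=> nr; rewrite qenergyE qradiusE.
apply: (@sum_error n.+1 (fun j => u j ^+ 2) (fun j => qv (qnth s.1 j) ^+ 2)).
- by rewrite -addnn; lia.
- apply: le_trans (near_mul 0 0 nr); exact: normr_ge0.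
by move=> j; rewrite !expr2; exact: near_mul.
Qed.

Lemma iter_graeffe_supported u k :
  supported u -> supported (iter k (@graeffe_coef R) u).
Proof. by move=> u0; elim: k => //= k IH; exact: graeffe_supported. Qed.

Lemma near_iter u s k : supported u -> near u s ->
  near (iter k (@graeffe_coef R) u) (iter k (qstep n) s).
Proof.
move=> u0 nr; elim: k => //= k IH; apply: near_step => //.
exact: iter_graeffe_supported.
Qed.

(** One step multiplies the radius, as long as it is at most 1, by no more than a
    constant that depends on the exact vector only. *)
Lemma near_small u k (e : R) : supported u -> 0 < e -> exists2 d : R, 0 < d &
  forall s, near u s -> qr s.2 < d -> qr (iter k (qstep n) s).2 < e.
Proof.
elim: k u e => [|k IH] u e u0 e0; first by exists e.
have [d d0 Hd] := IH (graeffe_coef u) e (graeffe_supported u0) e0.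
pose B := \sum_(j < n.+1) (`|u j| + 1) ^+ 2.
have B0 : 0 <= B by apply: sumr_ge0 => j _; exact: sqr_ge0.
have N1 : 1 <= n.*2.+1%:R :> R by rewrite ler1n.
set N : R := n.*2.+1%:R in N1; pose c := N * (2 * (1 + B) + 1).
have c0 : 0 < c by rewrite /c; nra.
exists (Num.min 1 (d / c)); first by rewrite lt_min ltr01 divr_gt0.
move=> s nr; rewrite lt_min => /andP [r1 rd]; rewrite iterSr.
apply: Hd; first exact: near_step.
have [r0 H _] := nr.
rewrite /= qradiusE; set S := \sum_(j < _) _.
have SB : S <= B.
  apply: ler_sum => j _; rewrite -real_normK ?num_real //.
  rewrite lerXn2r ?nnegrE ?addr_ge0 //.
  have := H j; rewrite distrC => Hj; have := ler_normD (qr (qnth s.1 j) - u j) (u j).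
  by rewrite subrK; lra.
have S0 : 0 <= S by apply: sumr_ge0 => j _; exact: sqr_ge0.
move: rd; rewrite ltr_pdivlMr // => rd; apply: le_lt_trans rd.
rewrite mulrCA /c; apply: ler_wpM2l => //; apply: ler_wpM2l; last lra.
by rewrite (le_trans _ N1).
Qed.

End Approximation.

Section EnergyCuts.
Context {R : realType} {T : Type} {nT : named T}.
Variables (n : nat) (u : T -> nat -> R).
Hypothesis u0 : forall t, supported n (u t).
Hypothesis cu : forall j, creal (fun t => u t j).

Let E t k := \sum_(j < n.+1) iter k (@graeffe_coef R) (u t) j ^+ 2.

Definition initial (L : seq frac) : seq frac :=
  [seq qnth L j | j <- iota 0 n.+1].

Definition encloses t (L : seq frac) (r : frac) : Prop := forall j : 'I_n.+1,
  qv (qadd (qnth L j) (qopp r)) < u t j /\ u t j < qv (qadd (qnth L j) r).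

Lemma encloses_near t L r : encloses t L r -> near n (u t) (initial L, r).
Proof.
move=> H; have r0 : 0 <= qv r :> R.
  by have [] := H ord0; rewrite !qvD qvN; lra.
split=> //= j; last by move=> nj; rewrite /qnth nth_default // size_map size_iota.
have [nj|jn] := ltnP n j.
  by rewrite /qnth nth_default ?size_map ?size_iota // qv0 u0 // subrr normr0.
rewrite qnth_iota //; have [] := H (Ordinal (jn : (j < n.+1)%N)).
by rewrite /= !qvD qvN ler_norml => ? ?; apply/andP; split; lra.
Qed.

Lemma encloses_exists t (d : R) : 0 < d ->
  exists L r, encloses t L r /\ qv r < d.
Proof.
move=> d0; have [r /andP [r0 rd]] := qv_dense d0.
have Hj j : exists q, u t j - qv r < qv q < u t j + qv r.
  by apply: qv_dense; lra.
have [f Hf] := choice Hj; exists [seq f j | j <- iota 0 n.+1], r; split=> // j.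
rewrite qnth_iota ?ltn_ord //.
by rewrite !qvD qvN; have /andP [] := Hf j; lra.
Qed.

Definition refined (k : nat) (L : seq frac) (r : frac) : approx :=
  iter k (qstep n) (initial L, r).

Lemma energy_approx t k L r : encloses t L r ->
  `|E t k - qv (qenergy n (refined k L r).1)| <= qv (qradius n (refined k L r)).
Proof. by move=> H; apply: near_energy; apply: near_iter => //; exact: encloses_near. Qed.

Lemma energy_approx_small t k (e : R) : 0 < e -> exists L r, encloses t L r /\
  qv (qradius n (refined k L r)) < e.
Proof.
move=> e0; have [d d0 Hd] := near_small k.+1 (@u0 t) e0.
have [L [r [H rd]]] := encloses_exists t d0.
by exists L, r; split=> //; apply: (Hd (initial L, r) (encloses_near H)).
Qed.

Lemma re_encloses (U : Type) {nU : named U} (f : U -> T) (g : U -> seq frac)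
  (h : U -> frac) : comp f -> comp g -> comp h ->
  re (fun x => encloses (f x) (g x) (h x)).
Proof.
move=> cf cg ch; apply: re_forall => j.
have cuf : creal (fun x => u (f x) j) by exact: (creal_comp (cu j) cf).
have cgj := comp_qnth j cg.
by apply: re_and; [apply: re_gtq | apply: re_ltq]; rewrite //; qcomp.
Qed.

Lemma creal_energy : creal (fun p : T * nat => E p.1 p.2).
Proof.
have cS (U : Type) (nU : named U) (f : U -> nat) (g : U -> seq frac)
    (h : U -> frac) : comp f -> comp g -> comp h ->
    comp (fun x => refined (f x) (g x) (h x)).
  move=> cf cg ch; apply: comp_iter => //; first exact: comp_qstep.
  by apply: comp_pair => //; apply: comp_map => j; exact: comp_qnth.
have c1 : comp (fun p : T * nat * frac * seq frac * frac => p.1.1.1.2) by qcomp.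
have c2 : comp (fun p : T * nat * frac * seq frac * frac => p.1.2) by qcomp.
have c3 : comp (fun p : T * nat * frac * seq frac * frac => p.2) by qcomp.
have c4 : comp (fun p : T * nat * frac * seq frac * frac => p.1.1.1.1) by qcomp.
have c5 : comp (fun p : T * nat * frac * seq frac * frac => p.1.1.2) by qcomp.
have cSp := cS _ _ _ _ _ c1 c2 c3.
have cR := comp_qradius n cSp; have cE := comp_qenergy n (comp_fst cSp).
split.
  apply: (re_iff (Q := fun p : T * nat * frac => exists L r,
    encloses p.1.1 L r /\ (qv (qadd p.2 (qradius n (refined p.1.2 L r))) : R)
                          < qv (qenergy n (refined p.1.2 L r).1))).
    case=> [[t k] q] /=; split=> [lt|[L [r [H]]]]; last first.
      by rewrite qvD; have := energy_approx k H; rewrite ler_norml => /andP []; lra.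
    have e0 : 0 < (E t k - qv q) / 2 by rewrite divr_gt0 // subr_gt0.
    have [L [r [H small]]] := energy_approx_small t k e0.
    exists L, r; split=> //; rewrite qvD; have := energy_approx k H.
    by rewrite ler_norml => /andP [] ; lra.
  do 2!apply: re_ex; apply: re_and; first exact: re_encloses.
  by apply: re_qv_lt => //; exact: comp_qadd.
apply: (re_iff (Q := fun p : T * nat * frac => exists L r,
  encloses p.1.1 L r /\ (qv (qadd (qenergy n (refined p.1.2 L r).1)
                                  (qradius n (refined p.1.2 L r))) : R) < qv p.2)).
  case=> [[t k] q] /=; split=> [lt|[L [r [H]]]]; last first.
    by rewrite qvD; have := energy_approx k H; rewrite ler_norml => /andP []; lra.
  have e0 : 0 < (qv q - E t k) / 2 by rewrite divr_gt0 // subr_gt0.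
  have [L [r [H small]]] := energy_approx_small t k e0.
  exists L, r; split=> //; rewrite qvD; have := energy_approx k H.
  by rewrite ler_norml => /andP [] ; lra.
do 2!apply: re_ex; apply: re_and; first exact: re_encloses.
by apply: re_qv_lt => //; exact: comp_qadd.
Qed.

End EnergyCuts.

(** * The topological entropy of a plant *)

Section CharacteristicPolynomial.
Context {R : realType} {T : Type} {nT : named T}.
Implicit Types p q : T -> {poly R}.

Definition cpoly p : Prop := forall j, creal (fun t => (p t)`_j).

Lemma cpoly_ext p q : p =1 q -> cpoly p -> cpoly q.
Proof. by move=> /funext <-. Qed.

Lemma cpolyM p q : cpoly p -> cpoly q -> cpoly (fun t => p t * q t).
Proof.
move=> cp cq j; apply: (creal_ext (x := fun t =>
  \sum_(i < j.+1) (p t)`_i * (q t)`_(j - i)%N)) => [t|]; first by rewrite coefM.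
by apply: creal_sum => i; apply: creal_mul.
Qed.

Lemma cpolyB p q : cpoly p -> cpoly q -> cpoly (fun t => p t - q t).
Proof.
move=> cp cq j; apply: (creal_ext (x := fun t => (p t)`_j - (q t)`_j)) => [t|].
  by rewrite coefB.
exact: creal_sub.
Qed.

Lemma cpolyN p : cpoly p -> cpoly (fun t => - p t).
Proof.
move=> cp j; apply: (creal_ext (x := fun t => - (p t)`_j)) => [t|].
  by rewrite coefN.
exact: creal_opp.
Qed.

Lemma cpoly_const_nat (r : {poly R}) (f : nat -> nat) :
  (forall j, r`_j = (f j)%:R) -> cpoly (fun _ => r).
Proof.
move=> rE j; apply: (creal_ext (x := fun _ => (f j)%:R)) => [t|].
  by rewrite rE.
exact: creal_const_nat.
Qed.

Lemma cpoly_sum (I : Type) (s : seq I) (P : pred I) (p : I -> T -> {poly R}) :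
  (forall i, cpoly (p i)) -> cpoly (fun t => \sum_(i <- s | P i) p i t).
Proof.
move=> cp j; apply: (creal_ext (x := fun t => \sum_(i <- s | P i) (p i t)`_j)).
  by move=> t; rewrite coef_sum.
by apply: creal_sum => i; exact: cp.
Qed.

Lemma cpoly_prod (I : Type) (s : seq I) (p : I -> T -> {poly R}) :
  (forall i, cpoly (p i)) -> cpoly (fun t => \prod_(i <- s) p i t).
Proof.
move=> cp; elim: s => [|i s IH].
  apply: (cpoly_ext (p := fun _ => 1)) => [t|]; first by rewrite big_nil.
  by apply: (@cpoly_const_nat _ (fun j => (j == 0)%N)) => j; rewrite coef1.
apply: (cpoly_ext (p := fun t => p i t * \prod_(i <- s) p i t)) => [t|].
  by rewrite big_cons.
exact: cpolyM.
Qed.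

Lemma cpoly_char_poly n (A : T -> 'M[R]_n) :
  (forall i j, creal (fun t => A t i j)) -> cpoly (fun t => char_poly (A t)).
Proof.
move=> cA; pose M i j t : {poly R} := 'X *+ (i == j) - (A t i j)%:P.
have cM i j : cpoly (M i j).
  apply: cpolyB => k.
    apply: (cpoly_const_nat (f := fun k => (k == 1) * (i == j))%N) => l.
    by rewrite coefMn coefX natrM mulr_natr.
  apply: (creal_ext (x := fun t => A t i j * ((k == 0)%N)%:R)) => [t|].
    by rewrite coefC; case: k => [|k]; rewrite /= ?mulr1 ?mulr0.
  by apply: creal_mul => //; exact: creal_const_nat.
apply: (cpoly_ext (p := fun t =>
  \sum_(s : {perm 'I_n}) (if odd_perm s then - \prod_i M i (s i) t
                   else \prod_i M i (s i) t))) => [t|].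
  rewrite /char_poly /determinant; apply: eq_bigr => s _.
  have -> : \prod_i (char_poly_mx (A t)) i (s i) = \prod_i M i (s i) t.
    by apply: eq_bigr => i _; rewrite !mxE.
  by case: odd_perm; rewrite ?expr1 ?mulN1r // expr0 mul1r.
apply: cpoly_sum => s; have cs := cpoly_prod (index_enum _) (fun i => cM i (s i)).
by case: odd_perm => //; exact: cpolyN.
Qed.

End CharacteristicPolynomial.

Lemma map_graeffe (F F' : comNzRingType) (f : {rmorphism F -> F'})
  (p : {poly F}) : map_poly f (graeffe p) = graeffe (map_poly f p).
Proof.
apply/polyP => i; rewrite coef_map /= !coef_graeffe /graeffe_coef rmorph_sum.
apply: eq_bigr => j _.
by rewrite !coef_map /= !rmorphM /= rmorphXn /= rmorphN1.
Qed.

Section Eta.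
Variables (R : realType) (n : nat).
Local Notation C := R[i]%C.
Local Notation rc := (real_complex R).
Implicit Types (A : 'M[R]_n) (p : {poly R}).

Lemma eta_mahler A : Defs.eta A * ln 2 = ln (mahler (eigenvalues A)).
Proof.
rewrite /Defs.eta /mahler mulr_suml; elim: (eigenvalues A) => [|z s IH].
  by rewrite !big_nil ln1.
rewrite !big_cons lnM ?posrE; last 2 first.
- by rewrite lt_max ltr01.
- by have := mahler_ge1 s; exact: lt_le_trans.
rewrite -IH; case: (leP 1 (modulus z)) => z1; last by rewrite ln1 add0r.
by rewrite /log2 divfK // lt0r_neq0 // ln2_gt0.
Qed.

Lemma eigenvalues_poly A :
  map_poly rc (char_poly A) = \prod_(z <- eigenvalues A) ('X - z%:P).
Proof.
rewrite map_char_poly -/(complex_mx A) /eigenvalues.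
case: closed_field_poly_normal => s /= E.
by rewrite {1}E (monicP (char_poly_monic _)) scale1r.
Qed.

Lemma size_eigenvalues A : size (eigenvalues A) = n.
Proof.
have := congr1 (size : {poly C} -> nat) (eigenvalues_poly A).
by rewrite size_map_poly size_char_poly size_prod_XsubC => -[].
Qed.

Lemma iter_graeffe_coef p k :
  (fun j => (iter k (@graeffe R) p)`_j)
  = iter k (@graeffe_coef R) (fun j => p`_j).
Proof.
elim: k => //= k IH; apply: funext => j.
by rewrite coef_graeffe IH.
Qed.

Lemma char_poly_supported A : supported n (fun j => (char_poly A)`_j).
Proof. by move=> j nj; rewrite nth_default // size_char_poly. Qed.

Lemma energy_char_poly A k :
  energy (iter k (@graeffe C) (map_poly rc (char_poly A))) =
  \sum_(j < n.+1)
    iter k (@graeffe_coef R) (fun i => (char_poly A)`_i) j ^+ 2.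
Proof.
have -> : iter k (@graeffe C) (map_poly rc (char_poly A))
        = map_poly rc (iter k (@graeffe R) (char_poly A)).
  by elim: k => //= k ->; rewrite map_graeffe.
rewrite -iter_graeffe_coef (@energyE _ _ n.+1) ?size_map_poly; last first.
  apply/leq_sizeP => j nj.
  rewrite -[_`_j]/((fun i => (iter k (@graeffe R) (char_poly A))`_i) j).
  rewrite iter_graeffe_coef; apply: iter_graeffe_supported nj.
  exact: char_poly_supported.
by apply: eq_bigr => j _; rewrite coef_map /sqn /= expr0n addr0.
Qed.

Context {T : Type} {nT : named T}.

(** By the bounds for the energy [E], the logarithm of [E t k] divided by
    [2 ^ k.+1] differs from the logarithm of the Mahler measure by at most
    [n * ln 4 / 2 ^ k.+1]. *)
Lemma creal_eta (A : T -> 'M[R]_n) : (forall i j, creal (fun t => A t i j)) ->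
  creal (fun t => Defs.eta (A t) * ln 2).
Proof.
move=> cA; pose u t j := (char_poly (A t))`_j.
pose E t k := \sum_(j < n.+1) iter k (@graeffe_coef R) (u t) j ^+ 2.
have cE : creal (fun p : T * nat => E p.1 p.2).
  apply: creal_energy => [t|j]; first exact: char_poly_supported.
  exact: cpoly_char_poly.
have bounds t k := energy_graeffe_bounds k (modulus1 R)
  (esym (scale1r _) : _ = 1 *: \prod_(z <- eigenvalues (A t)) ('X - z%:P)).
have M0 t : 0 < mahler (eigenvalues (A t)).
  exact: lt_le_trans ltr01 (mahler_ge1 _).
have E0 t k : 0 < E t k.
  have := bounds t k; rewrite -eigenvalues_poly energy_char_poly => /andP [le _].
  by apply: lt_le_trans le; rewrite exprn_gt0.
pose y (p : T * nat) := ln (E p.1 p.2) * qv (qpow (1, 0, 1)%N p.2.+1).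
apply: (@creal_lim _ _ _ _ y (4 * n)).
  apply: creal_mul; first by apply: creal_ln cE => p; exact: E0.
  by apply: creal_qv; apply: comp_qpow; qcomp.
move=> t k; rewrite /y /= eta_mahler qvX; set M := mahler _.
have -> : qv (1, 0, 1)%N ^+ k.+1 = (2 ^ k.+1)%:R^-1 :> R.
  by rewrite /qv /= subr0 div1r exprVn natrX.
have := bounds t k; rewrite size_eigenvalues -eigenvalues_poly energy_char_poly.
rewrite -/(u t) -/(E t k) -/M; set N := (2 ^ k.+1)%N => /andP [le1 le2].
have N0 : 0 < N%:R :> R by rewrite ltr0n expn_gt0.
have l1 : N%:R * ln M <= ln (E t k).
  by rewrite mulr_natl -lnXn ?M0 // ler_ln ?posrE ?exprn_gt0 ?M0.
have l2 : ln (E t k) <= n%:R * ln 4%:R + N%:R * ln M.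
  rewrite !mulr_natl -!lnXn ?M0 // -lnM ?posrE ?exprn_gt0 ?M0 //.
  by rewrite ler_ln ?posrE ?mulr_gt0 ?exprn_gt0 ?M0.
have -> : ln (E t k) / N%:R - ln M = (ln (E t k) - N%:R * ln M) / N%:R.
  by field; exact: lt0r_neq0.
rewrite normrM [X in _ * X]ger0_norm ?invr_ge0 ?ler0n // ger0_norm; last lra.
have k0 : 0 < k.+1%:R :> R by rewrite ltr0n.
have kN : k.+1%:R <= N%:R :> R by rewrite ler_nat ltnW // ltn_expl.
have l4 : n%:R * ln 4%:R <= (4 * n)%:R :> R.
  by rewrite natrM mulrC ler_wpM2r // ltW // ln_sublinear.
by apply: ler_pM; rewrite ?invr_ge0 ?ler0n ?lef_pV2 ?posrE //; lra.
Qed.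

End Eta.

(** * Descriptions as names of instances *)

Section Descriptions.
Context {R : realType} {T : Type} {nT : named T}.

Definition parity (s : nat) : nat := iter s (fun b => 1 - b)%N 0%N.

Lemma parityE s : parity s = odd s :> nat.
Proof. by elim: s => //= s; rewrite /parity => ->; case: odd. Qed.

(** The parity of [s] moves [a] to the positive or to the negative part. *)
Definition signed_frac (a b s : nat) : frac :=
  (a * (1 - parity s), a * parity s, b.-1)%N.

Lemma qv_signed_frac a b s : b != 0%N ->
  qv (signed_frac a b s) = ratr ((-1) ^+ s * a%:R / b%:R) :> R.
Proof.
move=> b0; rewrite fmorph_div rmorphM rmorphXn rmorphN1 !rmorph_nat.
rewrite /qv /signed_frac /= prednK ?lt0n // !parityE -signr_odd; congr (_ / _).
by case: odd; rewrite ?muln1 ?muln0 ?subr0 ?sub0r ?expr1 ?mulN1r ?mul1r.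
Qed.

Lemma comp_signed_frac {U : Type} {nU : named U} (a b s : U -> nat) :
  comp a -> comp b -> comp s -> comp (fun u => signed_frac (a u) (b u) (s u)).
Proof.
move=> ca cb cs.
have cp : comp (fun u => parity (s u)).
  apply: comp_iter => //; last exact: comp_const.
  by apply: comp_sub; [exact: comp_const | exact: comp_id].
by rewrite /signed_frac; qcomp.
Qed.

Variables (d : T -> ratprog) (x : T -> R).
Hypothesis cd : comp (fun t => ratprog_num (d t)).
Hypothesis dx : forall t, describes (d t) (x t).

(** The programs of a description are run by the universal relation
    [evaluates]; the described real is the limit of the rationals they output. *)
Lemma creal_described : creal x.
Proof.
have H t : exists f : (nat -> nat) * (nat -> nat) * (nat -> nat),
   [/\ computes (num_prog (d t)) f.1.1, computes (den_prog (d t)) f.1.2,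
       computes (sgn_prog (d t)) f.2, forall k, f.1.2 k != 0%N
     & forall k, `|x t - qv (signed_frac (f.1.1 k) (f.1.2 k) (f.2 k))| < 2 ^- k].
  have [r [a [b [s [ca cb cs b0 rE]]]] H] := dx t.
  by exists (a, b, s); split=> //= k; rewrite qv_signed_frac // -rE.
have [f Hf] := choice H.
pose v t k : frac := signed_frac ((f t).1.1 k) ((f t).1.2 k) ((f t).2 k).
pose c t := unpair (ratprog_num (d t)).
pose runs t k (y : nat * nat * nat) := evaluates (c t).1 [:: k] y.1.1 /\
  (evaluates (unpair (c t).2).1 [:: k] y.1.2 /\
   evaluates (unpair (c t).2).2 [:: k] y.2).
have runsP t k y : runs t k y <-> y = ((f t).1.1 k, (f t).1.2 k, (f t).2 k).
  have [ca cb cs _ _] := Hf t; rewrite /runs /c /ratprog_num !npairK /=.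
  rewrite !evaluatesP; case: y => [[a b] s] /=; split; last by case=> -> -> ->.
  case=> ea [eb es].
  by rewrite (reval_det ea (ca k)) (reval_det eb (cb k)) (reval_det es (cs k)).
have re_ev (U : Type) (nU : named U) (e k y : U -> nat) : comp e -> comp k ->
    comp y -> re (fun u => evaluates (e u) [:: k u] (y u)).
  move=> ce ck cy; apply: (re_comp (f := fun u => (e u, [:: k u], y u)) _ re_evaluates).
  by qcomp.
have cc (U : Type) (nU : named U) (g : U -> T) : comp g -> comp (fun u => c (g u)).
  by move=> cg; apply: comp_unpair; exact: (comp_comp cd cg).
have re_runs (U : Type) (nU : named U) (g : U -> T) k y : comp g -> comp k ->
    comp y -> re (fun u => runs (g u) (k u) (y u)).
  move=> cg ck cy; have ccg := cc _ _ _ cg.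
  by apply: re_and; [|apply: re_and]; apply: re_ev; qcomp.
have cut (rel : frac -> frac -> Prop) :
    re (fun p : frac * frac => rel p.1 p.2) ->
    re (fun p : T * nat * frac => rel p.2 (v p.1.1 p.1.2)).
  move=> rrel; apply: (re_iff (Q := fun p : T * nat * frac => exists y,
    runs p.1.1 p.1.2 y /\ rel p.2 (signed_frac y.1.1 y.1.2 y.2))).
    case=> [[t k] q] /=; split=> [Hr|[y [/runsP -> //]]].
    by eexists; split; [apply/runsP; reflexivity | exact: Hr].
  apply: re_ex; apply: re_and; first by apply: re_runs; qcomp.
  apply: (re_comp (f := fun p : T * nat * frac * (nat * nat * nat) =>
    (p.1.2, signed_frac p.2.1.1 p.2.1.2 p.2.2)) _ rrel).
  by apply: comp_pair; [|apply: comp_signed_frac]; qcomp.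
apply: (@creal_lim _ _ _ _ (fun p : T * nat => qv (v p.1 p.2)) 1).
  split; first by apply: (cut (fun q w => qv q < qv w)); apply: re_qv_lt; qcomp.
  by apply: (cut (fun q w => qv w < qv q)); apply: re_qv_lt; qcomp.
move=> t k /=; have [_ _ _ _ /(_ k) lt] := Hf t.
rewrite distrC (le_trans (ltW lt)) // div1r lef_pV2 ?posrE ?exprn_gt0 ?ltr0n //.
by rewrite -natrX ler_nat ltn_expl.
Qed.

End Descriptions.

Section Instances.
Variables (R : realType) (X Y : finType) (n : nat).

Local Notation index := (('I_n * 'I_n) + (X * Y))%type.

(** The parameter space of the two decision problems. Only the descriptions enter
    the name, while the functions on this space may depend on the objects. *)
Definition instance : Type :=
  { w : ('M[R]_n * (X -> Y -> R)) * (index -> ratprog) |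
    plant_channel w.1 /\ forall i, describes (w.2 i) (pair_entry w.1 i) }.

Definition program_numbers (d : index -> ratprog) : seq nat :=
  [seq ratprog_num (d i) | i <- enum {: index}].

#[local] Instance named_instance : named instance :=
  fun w => tuple_code (program_numbers (sval w).2).

Lemma input_wordE d : input_word d = unary_word (program_numbers d).
Proof. by rewrite /unary_word -map_comp. Qed.

(** The code is nested to the left, so entries are counted from the end. *)
Lemma nth_tuple_code v k : (k < size v)%N ->
  nth 0%N v k =
  (unpair (iter (size v - k.+1) (fun m => (unpair m).1) (tuple_code v))).2.
Proof.
elim/last_ind: v => [//|v a IH]; rewrite size_rcons ltnS leq_eqVlt nth_rcons.
rewrite /tuple_code foldl_rcons -/(tuple_code v) => /orP [/eqP ->|kv].
  by rewrite ltnn eqxx subnn npairK.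
by rewrite kv IH // subSn // iterSr npairK.
Qed.

Lemma comp_program_number i :
  comp (fun w : instance => ratprog_num ((sval w).2 i)).
Proof.
pose N := size (enum {: index}); pose j := enum_rank i.
have jN : (j < N)%N by rewrite /N -cardE ltn_ord.
apply: (comp_ext (f := fun w : instance =>
  (unpair (iter (N - j.+1) (fun m => (unpair m).1) (nm w))).2)) => [w|].
  have := @nth_tuple_code (program_numbers (sval w).2) j.
  rewrite size_map => /(_ jN) <-.
  by rewrite (nth_map i) // nth_enum_rank.
apply: comp_snd; apply: comp_unpair; apply: comp_iter.
- by qcomp.
- exact: comp_const.
by exists (PPair PFst PSnd) => w; rewrite /= unpairK.
Qed.

Lemma creal_pair_entry i : creal (fun w : instance => pair_entry (sval w).1 i).
Proof.
apply: (creal_described (comp_program_number i)) => w.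
by case: (svalP w) => _; exact.
Qed.

Lemma creal_instance_eta : creal (fun w : instance => Defs.eta (sval w).1.1 * ln 2).
Proof. by apply: creal_eta => i j; exact: (creal_pair_entry (inl (i, j))). Qed.

Lemma creal_instance_capacity :
  creal (fun w : instance => capacity (sval w).1.2 * ln 2).
Proof.
apply: creal_capacity => [w x|x y]; last exact: (creal_pair_entry (inr (x, y))).
by case: (svalP w) => -[_ /(_ x) []].
Qed.

Lemma semi_decidable_instance (M : set ('M[R]_n * (X -> Y -> R))) :
  (M `<=` @plant_channel R X Y n)%classic ->
  re (fun w : instance => M (sval w).1) ->
  semi_decidable (@pair_entry R X Y n) (@plant_channel R X Y n) M.
Proof.
move=> MD [e He]; split=> //.
have reP : reN (fun v => exists B, pev e (npair v B) = 0%N) by exists e.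
have [M' HM'] := reN_machine #|{: index}| reP; exists M' => p d Dp dp.
rewrite input_wordE HM'; last by rewrite size_map -cardE.
have := He (exist _ (p, d) (conj Dp dp)).
by rewrite /nm /named_instance /= => ->.
Qed.

End Instances.

Theorem theorem44 (R : realType) (X Y : finType) (n : nat) (hn : (0 < n)%N) :
  semi_decidable (@pair_entry R X Y n) (@plant_channel R X Y n) (@S_gt R X Y n) /\
  semi_decidable (@pair_entry R X Y n) (@plant_channel R X Y n) (@S_lt R X Y n).
Proof.
have l2 := ln2_gt0 R.
have ce := @creal_instance_eta R X Y n; have cc := @creal_instance_capacity R X Y n.
split; apply: semi_decidable_instance => [p []//|].
  apply: re_iff (creal_lt cc ce) => w; rewrite ltr_pM2r // -subr_gt0.
  by split=> [[] //|lt]; split=> //; case: (svalP w).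
apply: re_iff (creal_lt ce cc) => w; rewrite ltr_pM2r // -subr_lt0.
by split=> [[] //|lt]; split=> //; case: (svalP w).
Qed.
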